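(* Let $r>0$, $\sigma>0$, $\gamma\in\mathbb{R}$, and let $G=(-\infty,\gamma]$ or $G=(-\infty,\gamma)$. Assume that under the risk-neutral measures $(\mathbb{P}^x)_{x\in\mathbb{R}}$, $X_t=X_0+\sigma B_t+\left(r-\frac{\sigma^2}{2}\right)t$ for all $t\ge0$, where $B$ is a normalised one-dimensional Brownian motion and $X_0=x$ $\mathbb{P}^x$-a.s. (that is, $X$ is the logarithmic price process of the one-dimensional Black-Scholes model with constant volatility $\sigma$ and discount rate $r$). Put $\mu:=r-\frac{\sigma^2}{2}$. (i) If $\mu\ge0$, there exist constants $c_0,C_0>0$ such that for all sufficiently small $s>0$, $$c_0s^{\frac12}\le\rho(s)(\gamma)\le C_0s^{\frac{1}{2\sqrt2}}.$$ (ii) If both $\mu\le0$ and $r>\frac{\mu^2}{2\sigma^2}$, there exist constants $c_1,C_1>0$ such that for all sufficiently small $s>0$, $$c_1s^{\frac{1}{\sqrt2}}\le\rho(s)(\gamma)\le C_1s^{\frac12}.$$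
   Context: $\mathbb{N}=\{1,2,\dots\}$; $\mathbb{E}^x$ is expectation under $\mathbb{P}^x$. For $t>0$, $\tau_G^{t\mathbb{N}}:=\min\{u\in t\mathbb{N}:X_u\in G\}$ ($=+\infty$ if there is no such $u$, with $e^{-r\cdot\infty}=0$), and $$\rho(s)(x):=\lim_{t\downarrow0}\mathbb{E}^x\left[e^{-r\tau_G^{t\mathbb{N}}}-e^{-r\tau_G^{s\mathbb{N}}}\right].$$ *)

(* Defs.v *)
From HB Require Import structures.
From mathcomp Require Import all_boot all_order all_algebra.
From mathcomp Require Import all_classical all_reals all_analysis.

Set Implicit Arguments.
Unset Strict Implicit.
Unset Printing Implicit Defensive.

Import Order.TTheory GRing.Theory Num.Theory.
Import numFieldTopology.Exports numFieldNormedType.Exports.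

Local Open Scope classical_set_scope.
Local Open Scope ring_scope.

(* Processes are families of random variables indexed by R; only the values at
   times t >= 0 are ever used. *)

(* Taking some of the A i to be setT yields the product rule for every
   subfamily. *)
Definition mutually_independent (R : realType) (d : measure_display)
    (T : measurableType d) (P : probability T R) (n : nat)
    (Y : 'I_n -> T -> R) : Prop :=
  forall A : 'I_n -> set R, (forall i, measurable (A i)) ->
    P (\bigcap_i (Y i @^-1` A i)) =
    (\prod_(i < n) P (Y i @^-1` A i))%E.

(* The second argument of normal_prob is the standard deviation. *)
Record brownian_motion (R : realType) (d : measure_display)
    (T : measurableType d) (P : probability T R)
    (B : R -> {mfun T >-> R}) : Prop := {
  bm_start : {ae P, forall w, B 0 w = 0};
  bm_gaussian : forall s t : R, 0 <= s -> s < t ->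
    forall A : set R, measurable A ->
      P ((fun w => B t w - B s w) @^-1` A) =
      normal_prob 0 (Num.sqrt (t - s)) A;
  bm_indep : forall (n : nat) (t : nat -> R), 0 <= t 0 ->
    (forall i, (i < n)%N -> t i <= t i.+1) ->
    mutually_independent P
      (fun (i : 'I_n) w => B (t i.+1) w - B (t i) w);
  bm_continuous :
    {ae P, forall w, {within `[0, +oo[, continuous (fun t : R => B t w)}}
}.

Definition grid (R : realType) (t : R) : set R :=
  [set u | exists2 n : nat, (0 < n)%N & u = n%:R * t].

(* For t > 0 a nonempty subset of the grid has a least element, so that the
   infimum is a minimum; the infimum of the empty set is +oo. *)
Definition grid_hitting_time (R : realType) (T : Type) (X : R -> T -> R)
    (G : set R) (t : R) (w : T) : \bar R :=
  ereal_inf (EFin @` [set u | grid t u /\ G (X u w)]).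

(* For r > 0, discount r +oo = 0. *)
Definition discount (R : realType) (r : R) (u : \bar R) : R :=
  fine (expeR (- (r%:E * u))%E).

Definition rho (R : realType) (d : measure_display) (T : measurableType d)
    (P : R -> probability T R) (X : R -> T -> R) (r : R) (G : set R)
    (s x : R) : \bar R :=
  lim ((fun t : R =>
          expectation (P x)
            (fun w => discount r (grid_hitting_time X G t w)
                      - discount r (grid_hitting_time X G s w)))
       @ 0^'+).

(* Main.v *)
Require Import Defs.
From HB Require Import structures.
From mathcomp Require Import all_boot all_order all_algebra.
From mathcomp Require Import all_classical all_reals all_analysis.
From mathcomp Require Import measurable_realfun.
From mathcomp Require Import zify ring lra.

Import Order.TTheory GRing.Theory Num.Theory.
Import numFieldTopology.Exports numFieldNormedType.Exports.

Local Open Scope classical_set_scope.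
Local Open Scope ring_scope.

Set Implicit Arguments.
Unset Strict Implicit.
Unset Printing Implicit Defensive.

(** Write Y for the increments of B along the grid of mesh s. Relative to
gamma and divided by sigma, the process X started at gamma and observed on
that grid is the random walk with steps Y_i + mu * s / sigma, and the hitting
time of G is the first time at which this walk stops being positive. (Whether
G is open or closed is immaterial, because the walk has no atoms.) Let u_n be
the probability that the walk is positive at times 1, ..., n.

Since the mesh t tends to 0 in the definition of rho, and the expected loss
1 - E e^(-r tau) at mesh t tends to 0 as well, rho(s)(gamma) is the expected
loss at mesh s. A walk that has survived n steps has been discounted for a
time at least n * s, and one that has not survived has lost at most r * s for each
step that it has begun, so that
  (1 - e^(-r n s)) u_n <= loss <= r s (u_0 + ... + u_(n-1)) + u_n.
Both bounds are used for n about 1/s; they are [expected_loss_ge] and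
[expected_loss_le].

Without drift, u_n is of exact order n^(-1/2). Splitting a path of length n at
its first minimum k, the part after k is a walk that stays nonnegative, while
the part before k, read backwards and with signs changed, is a walk that stays
positive; by symmetry of the normal law this gives
  u_0 u_n + u_1 u_(n-1) + ... + u_n u_0 = 1     ([persistence_conv]).
Comparing triangular sums with squares, and using that u is nonincreasing,
yields the two-sided bound ([self_convolution_ge], [self_convolution_le]).
As u_n is monotone in the drift, this settles the bounds by s^(1/2): the lower
one for mu >= 0 and the upper one for mu <= 0.

In the other two bounds the drift works the wrong way, and the two walks are
compared by a change of measure. Over at most 1/s steps the likelihood ratio Z
has a fourth moment D bounded independently of s, and for every K > 0
  Z 1_A <= K 1_A + Z^4 / K^3,
so that probabilities with and without drift satisfy P(A) <= K P'(A) + D / K^3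
([iid_law_shift_le]). Taking K = s^(-1/8) turns the driftless s^(1/2) into an
upper bound of order s^(3/8), and K of order s^(-1/6) gives a lower bound of
order s^(2/3). These imply the stated exponents, since 1/(2 sqrt 2) <= 3/8
and 2/3 <= 1/sqrt 2. *)

(** * Measures on tuples and laws of independent samples *)

Section tuple_measures.
Context {d : measure_display} {T : measurableType d} {R : realType}.
Local Open Scope ereal_scope.

Definition box n (A : 'I_n -> set T) : set (n.-tuple T) :=
  \bigcap_i [set y | A i (tnth y i)].

Lemma measurable_box n (A : 'I_n -> set T) :
  (forall i, measurable (A i)) -> measurable (box A).
Proof.
move=> mA; apply: fin_bigcap_measurable => // i _.
by have := @measurable_tnth _ T n i measurableT _ (mA i); rewrite setTI.
Qed.

(** Boxes are stable under intersection and generate the product sigma-algebra. *)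
Lemma tuple_measure_unique n (m1 m2 : {measure set (n.-tuple T) -> \bar R}) :
  m1 setT < +oo ->
  (forall A, (forall i, measurable (A i)) -> m1 (box A) = m2 (box A)) ->
  forall E, measurable E -> m1 E = m2 E.
Proof.
move=> m1oo m12 E mE.
pose G := [set E | exists2 A : 'I_n -> set T,
  (forall i, measurable (A i)) & E = box A].
have GT : G setT.
  exists (fun=> setT) => //; rewrite /box; apply/seteqP; split => //.
apply: (measure_unique G (fun=> setT)) => //.
- rewrite /measurable/=; apply/seteqP; split.
  + apply: smallest_sub; first exact: smallest_sigma_algebra.
    rewrite -bigcup_seq => B [i _ [A mA <-]].
    apply: sub_sigma_algebra.
    exists (fun j => if j == i then A else setT) => [j|].
      by case: ifP.
    rewrite setTI; apply/seteqP; split => y /=.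
      by move=> Ay j _ /=; case: eqP => // ->.
    by move=> /(_ i I)/=; rewrite eqxx.
  + apply: smallest_sub; first exact: sigma_algebra_measurable.
    by move=> _ [A mA ->]; exact: measurable_box.
- move=> _ _ [A mA ->] [B mB ->].
  exists (fun i => A i `&` B i) => [i|]; first exact: measurableI.
  by rewrite /box -bigcapI.
- by rewrite bigcup_const.
- by move=> _ [A mA ->]; exact: m12.
Qed.

End tuple_measures.

Section iid_law.
Context {d : measure_display} {T : measurableType d} {R : realType}.
Local Open Scope ereal_scope.

Definition cons_pair n (xy : T * n.-tuple T) : n.+1.-tuple T :=
  [the n.+1.-tuple T of xy.1 :: xy.2].

Let measurable_cons_pair n : measurable_fun setT (@cons_pair n).
Proof. exact: measurable_cons. Qed.

HB.instance Definition _ n :=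
  isMeasurableFun.Build _ _ _ _ (@cons_pair n) (@measurable_cons_pair n).

Lemma tnth_cons_pair0 n xy : tnth (@cons_pair n xy) ord0 = xy.1.
Proof. by []. Qed.

Lemma tnth_cons_pairS n xy i : tnth (@cons_pair n xy) (lift ord0 i) = tnth xy.2 i.
Proof. by rewrite tnthS. Qed.

Variable Q : probability T R.

(** Built by prepending one coordinate at a time, so that integrals against it
are iterated integrals and can be computed by induction on the length. *)
Fixpoint iid_law n : probability (n.-tuple T) R :=
  if n is n'.+1 then distribution (Q \x iid_law n') (@cons_pair n')
  else [the probability _ _ of dirac [tuple]].

Lemma iid_law_box n (A : 'I_n -> set T) : (forall i, measurable (A i)) ->
  iid_law n (box A) = \prod_(i < n) Q (A i).
Proof.
elim: n A => [|n IHn] A mA.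
  rewrite big_ord0 /= diracE mem_set// => i _.
  by case: i.
rewrite /= /distribution /pushforward.
rewrite (_ : _ @^-1` _ = A ord0 `*` box (A \o lift ord0)); last first.
  apply/seteqP; split => -[x y].
    by move=> /= Axy; split => [|i _]; [exact: (Axy ord0)|
       have := Axy (lift ord0 i) I; rewrite /= tnth_cons_pairS].
  move=> [/= Ax Ay] i _ /=; case: (unliftP ord0 i) => [j|] ->//.
  by rewrite tnth_cons_pairS; exact: Ay.
rewrite product_measure1E//; last by apply: measurable_box => i; exact: mA.
rewrite big_ord_recl; congr (_ * _).
by apply: (IHn (fun i => A (lift ord0 i))) => i; exact: mA.
Qed.

Lemma ge0_integral_iidS n (F : n.+1.-tuple T -> \bar R) :
  measurable_fun setT F -> (forall y, 0 <= F y) ->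
  \int[iid_law n.+1]_y F y =
  \int[Q]_x \int[iid_law n]_y F (cons_pair (x, y)).
Proof.
move=> mF F0; rewrite ge0_integral_distribution//.
rewrite (@fubini_tonelli1 _ _ _ _ _ Q (iid_law n) (F \o @cons_pair n))//.
- exact: measurableT_comp.
- by move=> x; exact: F0.
Qed.

Definition likelihood (z : T -> R) n (y : n.-tuple T) : R :=
  (\prod_(i < n) z (tnth y i))%R.

Lemma measurable_likelihood (z : T -> R) n : measurable_fun setT z ->
  measurable_fun setT (@likelihood z n).
Proof.
move=> mz; apply: measurable_prod => i _.
exact: (measurableT_comp mz (@measurable_tnth _ _ _ i)).
Qed.

(** A density z relating Q to its image under g tensorises: the densities of the
coordinates multiply. This is Fubini together with induction on the length. *)
Lemma iid_change_of_variables (g : T -> T) (z : T -> R) :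
  measurable_fun setT g -> measurable_fun setT z -> (forall x, 0 <= z x)%R ->
  (forall f : T -> \bar R, measurable_fun setT f -> (forall x, 0 <= f x) ->
    \int[Q]_x f (g x) = \int[Q]_x (f x * (z x)%:E)) ->
  forall n (F : n.-tuple T -> \bar R),
    measurable_fun setT F -> (forall y, 0 <= F y) ->
  \int[iid_law n]_y F (map_tuple g y) =
  \int[iid_law n]_y (F y * (likelihood z y)%:E).
Proof.
move=> mg mz z0 gz; elim => [|n IHn] F mF F0.
  apply: eq_integral => y _; rewrite /likelihood big_ord0 mule1.
  by congr F; apply: eq_from_tnth => -[].
have mmap m : measurable_fun setT (@map_tuple m _ _ g).
  apply/measurable_fun_tnthP => i.
  rewrite (_ : _ \o _ = g \o (fun y => tnth y i)).
    exact: (measurableT_comp mg (@measurable_tnth _ _ _ i)).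
  by apply/funext => y/=; rewrite tnth_map.
have l0 m y : (0 <= @likelihood z m y)%R by apply: prodr_ge0.
rewrite ge0_integral_iidS//; last exact: (measurableT_comp mF (mmap n.+1)).
rewrite ge0_integral_iidS//; last first.
- by move=> y; rewrite mule_ge0// lee_fin.
- apply: emeasurable_funM => //.
  by apply/measurable_EFinP; apply: measurable_likelihood.
pose H x := \int[iid_law n]_y (F (cons_pair (x, y)) * (likelihood z y)%:E).
have mH : measurable_fun setT (fun xy : T * n.-tuple T =>
    F (cons_pair xy) * (likelihood z xy.2)%:E).
  apply: emeasurable_funM; first exact: measurableT_comp.
  apply/measurable_EFinP.
  by apply: (measurableT_comp (f := @likelihood z n)) => //; exact: measurable_likelihood.
transitivity (\int[Q]_x H (g x)).
  apply: eq_integral => x _.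
  rewrite /H; transitivity (\int[iid_law n]_y F (cons_pair (g x, map_tuple g y))).
    apply: eq_integral => y _; congr F; apply: eq_from_tnth => i.
    rewrite tnth_map; case: (unliftP ord0 i) => [j|] ->//.
    by rewrite !tnth_cons_pairS/= tnth_map.
  apply: (IHn (fun y => F (cons_pair (g x, y)))) => //.
  apply: (measurableT_comp mF).
  exact: (measurableT_comp (@measurable_cons_pair n) (measurable_pair1 _)).
rewrite (gz H).
- apply: eq_integral => x _.
  rewrite /H muleC -ge0_integralZl//.
  + apply: eq_integral => y _.
    rewrite muleCA -EFinM; congr (_ * (_)%:E).
    rewrite /likelihood big_ord_recl tnth_cons_pair0; congr *%R.
    by apply: eq_bigr => i _; rewrite tnth_cons_pairS.
  + by apply: (measurableT_comp mH (measurable_pair1 x)).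
  + by move=> y _; rewrite mule_ge0// lee_fin.
  + by rewrite lee_fin.
- apply: (measurable_fun_fubini_tonelli_F (m2 := iid_law n) _ mH) => xy.
  by rewrite mule_ge0// lee_fin.
- by move=> x; apply: integral_ge0 => y _; rewrite mule_ge0// lee_fin.
Qed.

End iid_law.

(** * The centred normal law and its translations *)

Section normal.
Context {R : realType}.
Local Open Scope ereal_scope.
Local Notation leb := (@lebesgue_measure R).

(** The normal density is a Radon-Nikodym derivative of the normal law, hence
agrees almost everywhere with the one provided by the general theorem, for
which the change of variables is known. *)
Lemma ge0_integral_normal_prob (m s : R) (f : R -> \bar R) :
  measurable_fun setT f -> (forall x, 0 <= f x) ->
  \int[normal_prob m s]_x f x = \int[leb]_x (f x * (normal_pdf m s x)%:E).
Proof.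
move=> mf f0.
have dom := normal_prob_dominates m s.
rewrite -(Radon_Nikodym_SigmaFinite.change_of_variables dom)//.
have hint := Radon_Nikodym_SigmaFinite.f_integrable dom.
have mpdf : measurable_fun setT (fun x => (normal_pdf m s x)%:E).
  by apply/measurable_EFinP; exact: measurable_normal_pdf.
apply: ge0_ae_eq_integral => //.
- by apply: emeasurable_funM => //; exact: measurable_int hint.
- exact: emeasurable_funM.
- by move=> x _; rewrite mule_ge0//; exact: Radon_Nikodym_SigmaFinite.f_ge0.
- by move=> x _; rewrite mule_ge0// lee_fin normal_pdf_ge0.
- apply: ae_eqe_mul2l; apply: integral_ae_eq => //.
  move=> A _ mA.
  by rewrite -(Radon_Nikodym_SigmaFinite.f_integral dom).
Qed.

Lemma ge0_integral_shift (c : R) (f : R -> \bar R) :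
  measurable_fun setT f -> (forall x, 0 <= f x) ->
  \int[leb]_x f (x + c)%R = \int[leb]_x f x.
Proof.
move=> mf f0.
have mshift : measurable_fun setT ((+%R^~ c) : R -> measurableTypeR R).
  exact: measurable_funD.
transitivity (\int[pushforward leb ((+%R^~ c) : R -> measurableTypeR R)]_x f x).
  by rewrite ge0_integral_pushforward.
apply: eq_measure_integral => A mA _.
apply/esym/lebesgue_measure_unique => // _ [[a b]] _ <-.
transitivity (leb ((+%R^~ c) @^-1` `]a, b])) => //.
rewrite (_ : _ @^-1` _ = `](a - c)%R, (b - c)%R]%classic); last first.
  by apply/seteqP; split => x /=; rewrite !in_itv/= ltrBlDr lerBrDr.
rewrite !lebesgue_measure_itv/= !lte_fin ltrD2r.
by case: ifP => // _; congr (_%:E); ring.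
Qed.

(** The density of N(c, s^2) with respect to N(0, s^2); the factor on the right is
the quotient of the two Gaussian densities. *)
Lemma normal_shift (s c : R) (f : R -> \bar R) : s != 0%R ->
  measurable_fun setT f -> (forall x, 0 <= f x) ->
  \int[normal_prob 0 s]_x f (x + c)%R =
  \int[normal_prob 0 s]_x (f x * (expR ((c * x - c ^+ 2 / 2) / s ^+ 2))%:E).
Proof.
move=> s0 mf f0.
have mz : measurable_fun setT (fun x : R => expR ((c * x - c ^+ 2 / 2) / s ^+ 2)).
  apply: measurableT_comp => //; apply: measurable_funM => //.
  by apply: measurable_funB => //; exact: measurable_funM.
have mf' : measurable_fun setT (fun x : R => f (x + c)%R).
  by apply: (measurableT_comp mf); exact: measurable_funD.
have mpdf := @measurable_normal_pdf R 0 s.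
rewrite !ge0_integral_normal_prob//; last 2 first.
- by apply: emeasurable_funM => //; exact/measurable_EFinP.
- by move=> x; rewrite mule_ge0// lee_fin expR_ge0.
rewrite -[LHS](ge0_integral_shift (- c)); last 2 first.
- by apply: emeasurable_funM => //; exact/measurable_EFinP.
- by move=> x; rewrite mule_ge0// lee_fin normal_pdf_ge0.
apply: eq_integral => x _; rewrite subrK -muleA -EFinM; congr (_ * _%:E).
rewrite normal_pdfE// mulrCA /normal_fun -expRD; congr (_ * expR _)%R.
by rewrite -mulr_natr; field.
Qed.

Lemma normal_opp (s : R) (A : set R) : s != 0%R -> measurable A ->
  normal_prob 0 s (-%R @^-1` A) = normal_prob 0 s A.
Proof.
move=> s0 mA.
have mN : measurable_fun setT (-%R : measurableTypeR R -> measurableTypeR R).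
  exact: measurable_funN.
rewrite /normal_prob.
have -> : \int[leb]_(x in A) (normal_pdf 0 s x)%:E =
    \int[pushforward leb (-%R : R -> measurableTypeR R)]_(x in A)
      (normal_pdf 0 s x)%:E.
  by apply: eq_measure_integral => B mB _; exact/esym/lebesgue_measureN.
rewrite (ge0_integral_pushforward mN)//; last 2 first.
- by apply/measurable_EFinP/measurable_funTS; exact: measurable_normal_pdf.
- by move=> x _; rewrite lee_fin normal_pdf_ge0.
apply: eq_integral => x _ /=; congr (_%:E).
by rewrite !normal_pdfE// /normal_fun !subr0 sqrrN.
Qed.

(** The same set function as the normal law, seen as a probability on the real
numbers with their own measurable structure, which is the one carried by
real random variables. *)
Definition centered_normal (s : R) : set R -> \bar R := normal_prob 0 s.

Section centered_normal_probability.
Variable s : R.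

HB.instance Definition _ := @isMeasure.Build _ R R (centered_normal s)
  (@measure0 _ _ _ (normal_prob 0 s)) (@measure_ge0 _ _ _ (normal_prob 0 s))
  (@measure_semi_sigma_additive _ _ _ (normal_prob 0 s)).

HB.instance Definition _ := @Measure_isProbability.Build _ R R
  (centered_normal s) (@probability_setT _ _ _ (normal_prob 0 s)).

Lemma ge0_integral_centered_normal (f : R -> \bar R) :
  measurable_fun setT f -> (forall x, 0 <= f x) ->
  \int[centered_normal s]_x f x = \int[normal_prob 0 s]_x f x.
Proof.
move=> mf f0.
have mid : measurable_fun setT (idfun : measurableTypeR R -> R).
  by move=> _ A mA; rewrite setTI; exact: mA.
transitivity (\int[pushforward (normal_prob 0 s) (idfun : measurableTypeR R -> R)]_x f x).
  exact: eq_measure_integral.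
by rewrite (ge0_integral_pushforward mid).
Qed.

Lemma centered_normal_shift (c : R) (f : R -> \bar R) : s != 0%R ->
  measurable_fun setT f -> (forall x, 0 <= f x) ->
  \int[centered_normal s]_x f (x + c)%R =
  \int[centered_normal s]_x (f x * (expR ((c * x - c ^+ 2 / 2) / s ^+ 2))%:E).
Proof.
move=> s0 mf f0; rewrite !ge0_integral_centered_normal//.
- exact: normal_shift.
- apply: emeasurable_funM => //; apply/measurable_EFinP.
  apply: measurableT_comp => //; apply: measurable_funM => //.
  by apply: measurable_funB => //; exact: measurable_funM.
- by move=> x; rewrite mule_ge0// lee_fin expR_ge0.
- by apply: (measurableT_comp mf); exact: measurable_funD.
Qed.

End centered_normal_probability.

Lemma normal_prob_set1 (m s x : R) : normal_prob m s [set x] = 0.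
Proof.
have /null_content_dominatesP := normal_prob_dominates m s.
by apply => //; exact: lebesgue_measure_set1.
Qed.

End normal.

(** * Change of drift for Gaussian samples *)

Section girsanov.
Context {R : realType}.
Local Open Scope ereal_scope.

Definition drift_density (s c x : R) : R := expR ((c * x - c ^+ 2 / 2) / s ^+ 2).

Lemma drift_density_ge0 s c x : (0 <= drift_density s c x)%R.
Proof. exact: expR_ge0. Qed.

Lemma measurable_drift_density s c : measurable_fun setT (drift_density s c).
Proof.
apply: measurableT_comp => //; apply: measurable_funM => //.
by apply: measurable_funB => //; exact: measurable_funM.
Qed.

Lemma likelihood_ge0 s c n (y : n.-tuple R) :
  (0 <= likelihood (drift_density s c) y)%R.
Proof. by apply: prodr_ge0 => i _; exact: drift_density_ge0. Qed.

Lemma measurable_map_shift n (c : R) :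
  measurable_fun setT (@map_tuple n _ _ (+%R^~ c)).
Proof.
apply/measurable_fun_tnthP => i.
rewrite (_ : _ \o _ = fun y => tnth y i + c)%R.
  apply: measurable_funD => //; exact: measurable_tnth.
by apply/funext => y/=; rewrite tnth_map.
Qed.

Lemma girsanov (s c : R) n (F : n.-tuple R -> \bar R) : s != 0%R ->
  measurable_fun setT F -> (forall y, 0 <= F y) ->
  \int[iid_law (centered_normal s) n]_y F (map_tuple (+%R^~ c) y) =
  \int[iid_law (centered_normal s) n]_y
    (F y * (likelihood (drift_density s c) y)%:E).
Proof.
move=> s0 mF F0.
apply: (@iid_change_of_variables _ _ _ (centered_normal s) (+%R^~ c)
  (drift_density s c)) => //.
- exact: measurable_funD.
- exact: measurable_drift_density.
- exact: drift_density_ge0.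
- by move=> f mf f0; exact: centered_normal_shift.
Qed.

(** A power of an exponential likelihood is, up to a constant, the likelihood of a
larger drift; its integral can therefore be read off without any further
Gaussian computation. *)
Lemma likelihood_pow4 s c n (y : n.-tuple R) : s != 0%R ->
  (likelihood (drift_density s c) y ^+ 4 =
   expR (6 * c ^+ 2 / s ^+ 2) ^+ n * likelihood (drift_density s (4 * c)) y)%R.
Proof.
move=> s0; rewrite /likelihood -prodrXl.
have -> : (expR (6 * c ^+ 2 / s ^+ 2) ^+ n = \prod_(i < n) expR (6 * c ^+ 2 / s ^+ 2))%R.
  by rewrite prodr_const card_ord.
rewrite -big_split /=; apply: eq_bigr => i _.
by rewrite /drift_density -expRM_natl -expRD; congr expR; field.
Qed.

Lemma integral_likelihood_pow4 s c n : s != 0%R ->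
  \int[iid_law (centered_normal s) n]_y
    (likelihood (drift_density s c) y ^+ 4)%:E =
  (expR (6 * c ^+ 2 / s ^+ 2) ^+ n)%:E.
Proof.
move=> s0; under eq_integral do rewrite likelihood_pow4// EFinM.
rewrite ge0_integralZl//; last 2 first.
- apply/measurable_EFinP; apply: measurable_likelihood.
  exact: measurable_drift_density.
- by move=> y _; rewrite lee_fin likelihood_ge0.
under eq_integral do rewrite -[X in X%:E]mul1r EFinM.
rewrite -(girsanov _ (F := cst 1))// integral_cst// mul1e.
by rewrite [X in _ * X]probability_setT mule1.
Qed.

(** If Z is the likelihood ratio of the shift, the left-hand side is the integral
of Z over E. The inequality Z 1_E <= K 1_E + Z^4 / K^3, clear where Z <= K, and
where Z > K because there Z^4 / K^3 exceeds Z, leaves only the fourth moment of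
Z. Optimised over K it is Hoelder's inequality with exponents 4/3 and 4, up to a
constant; a free K is easier to use. *)
Lemma iid_law_shift_le (s c K : R) n (E : set (n.-tuple R)) : s != 0%R ->
  (0 < K)%R -> measurable E ->
  iid_law (centered_normal s) n (map_tuple (+%R^~ c) @^-1` E) <=
  K%:E * iid_law (centered_normal s) n E
  + (expR (6 * c ^+ 2 / s ^+ 2) ^+ n / K ^+ 3)%:E.
Proof.
move=> s0 K0 mE; set Q := iid_law _ n; set Z := @likelihood _ _ R (drift_density s c) n.
have mZ : measurable_fun setT (Z : n.-tuple R -> R).
  by apply: measurable_likelihood; exact: measurable_drift_density.
have mE' : measurable (map_tuple (+%R^~ c) @^-1` E : set (n.-tuple R)).
  by have := @measurable_map_shift n c measurableT _ mE; rewrite setTI.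
rewrite -(setIT (_ @^-1` _)) -integral_indic//.
rewrite (_ : \int[_]_y _ = \int[Q]_y ((\1_E y)%:E * (Z y)%:E)); last first.
  by rewrite -girsanov//; exact/measurable_EFinP.
apply: (@le_trans _ _ (\int[Q]_y (K%:E * (\1_E y)%:E + (K ^- 3)%:E * (Z y ^+ 4)%:E))).
  apply: ge0_le_integral => //.
  - by move=> y _; rewrite -EFinM lee_fin mulr_ge0// likelihood_ge0.
  - by apply: emeasurable_funM; exact/measurable_EFinP.
  - apply: emeasurable_funD; apply/measurable_EFinP/measurable_funM => //.
    exact: measurable_funX.
  - move=> y _; rewrite -!EFinM -EFinD lee_fin.
    have Z0 : (0 <= Z y)%R := likelihood_ge0 _ _ _.
    have K3 : (0 < K ^+ 3)%R by rewrite exprn_gt0.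
    have h0 : (0 <= K ^- 3 * Z y ^+ 4)%R.
      by rewrite mulr_ge0 ?invr_ge0 ?exprn_ge0// ltW.
    rewrite indicE; case: (y \in E); rewrite /= ?mul1r ?mulr1 ?mul0r ?mulr0 ?add0r//.
    have [ZK|KZ] := leP (Z y) K; first by rewrite (le_trans ZK)// lerDl.
    apply: ler_wpDl; first exact: ltW.
    rewrite mulrC ler_pdivlMr// (exprS _ 3) ler_wpM2l//.
    by rewrite lerXn2r// ?nnegrE// ltW.
rewrite ge0_integralD//; last 4 first.
- by move=> y _; rewrite mule_ge0// lee_fin// ltW.
- by apply/measurable_EFinP/measurable_funM.
- by move=> y _; rewrite mule_ge0// lee_fin ?invr_ge0 exprn_ge0 ?likelihood_ge0// ltW.
- by apply/measurable_EFinP/measurable_funM => //; exact: measurable_funX.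
rewrite ge0_integralZl//; last 2 first.
- exact/measurable_EFinP.
- by rewrite lee_fin ltW.
rewrite integral_indic// setIT leeD2l//.
rewrite ge0_integralZl//; last 3 first.
- by apply/measurable_EFinP; exact: measurable_funX.
- by move=> y _; rewrite lee_fin exprn_ge0// likelihood_ge0.
- by rewrite lee_fin invr_ge0 exprn_ge0// ltW.
by rewrite integral_likelihood_pow4// -EFinM mulrC.
Qed.

End girsanov.

(** * Windows of an independent sequence, and reversal *)

Section image_measure.
Context {d d' : measure_display} {T1 : measurableType d}
  {T2 : measurableType d'} {R : realType}.
Definition image_measure (m : {measure set T1 -> \bar R}) (f : T1 -> T2)
  (mf : measurable_fun setT f) : {measure set T2 -> \bar R}.
Proof.
by unshelve refine [the {measure set T2 -> \bar R} of pushforward m f].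
Defined.
End image_measure.

Section iid_vectors.
Context {d : measure_display} {T : measurableType d} {R : realType}.
Context {d' : measure_display} {S : measurableType d'}.
Local Open Scope ereal_scope.
Variables (P : probability T R) (Q : probability S R) (Y : nat -> T -> S).
Hypothesis mY : forall i, measurable_fun setT (Y i).
Hypothesis Ylaw : forall n (A : 'I_n -> set S), (forall i, measurable (A i)) ->
  P (\bigcap_(i : 'I_n) (Y i @^-1` A i)) = \prod_(i < n) Q (A i).

Definition window k n (w : T) : n.-tuple S := [tuple Y (k + i) w | i < n].

Lemma measurable_window k n : measurable_fun setT (window k n).
Proof.
apply/measurable_fun_tnthP => i.
rewrite (_ : _ \o _ = Y (k + i))//.
by apply/funext => w /=; rewrite tnth_mktuple.
Qed.

Let mpre k n (E : set (n.-tuple S)) : measurable E ->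
  measurable (window k n @^-1` E).
Proof.
by move=> mE; have := @measurable_window k n measurableT _ mE; rewrite setTI.
Qed.

Let window_box k n (A : 'I_k -> set S) (B : 'I_n -> set S) :
  (forall i, measurable (A i)) -> (forall i, measurable (B i)) ->
  P (window 0 k @^-1` box A `&` window k n @^-1` box B) =
  iid_law Q k (box A) * iid_law Q n (box B).
Proof.
move=> mA mB; rewrite !iid_law_box//.
(* Both windows together are the first k + n variables, cut at k. *)
pose C (i : 'I_(k + n)) := match fintype.split i with inl j => A j | inr j => B j end.
transitivity (P (\bigcap_(i : 'I_(k + n)) (Y i @^-1` C i))).
  congr (P _); apply/seteqP; split => w /=.
    move=> [Aw Bw] i _ /=; rewrite /C; case: splitP => j ij.
      by have := Aw j I; rewrite /= tnth_mktuple ij.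
    by have := Bw j I; rewrite /= tnth_mktuple ij.
  move=> Cw; split => i _ /=; rewrite tnth_mktuple.
    by have := Cw (lshift n i) I; rewrite /C /= (unsplitK (inl i)).
  by have := Cw (rshift k i) I; rewrite /C /= (unsplitK (inr i)).
rewrite Ylaw; last by move=> i; rewrite /C; case: fintype.split.
rewrite big_split_ord /=; congr (_ * _); apply: eq_bigr => i _; rewrite /C.
  by rewrite (unsplitK (inl i)).
by rewrite (unsplitK (inr i)).
Qed.

Let law_mscale m (G : set (m.-tuple S)) : measurable G ->
  exists r : {nonneg R}, iid_law Q m G = r%:num%:E.
Proof.
move=> mG; exists (NngNum (fine_ge0 (measure_ge0 (iid_law Q m) G))).
by rewrite /= fineK// fin_num_measure.
Qed.

(** The law of a family of independent variables is only known on boxes; the two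
events are extended from boxes to arbitrary sets one after the other. *)
Lemma windows_independent k n (E : set (k.-tuple S)) (F : set (n.-tuple S)) :
  measurable E -> measurable F ->
  P (window 0 k @^-1` E `&` window k n @^-1` F) =
  iid_law Q k E * iid_law Q n F.
Proof.
move=> mE mF.
have box_left B : (forall i, measurable (B i)) ->
    P (window 0 k @^-1` E `&` window k n @^-1` box B) =
    iid_law Q k E * iid_law Q n (box B).
  move=> mB; have mBb := measurable_box mB.
  have [r rE] := law_mscale mBb.
  rewrite rE muleC.
  pose m1 := image_measure (mrestr P (@mpre k n _ mBb)) (@measurable_window 0 k).
  pose m2 : {measure set (k.-tuple S) -> \bar R} := mscale r (iid_law Q k).
  suff : m1 E = m2 E by [].
  apply: tuple_measure_unique => //.
    by rewrite /= /pushforward /= (le_lt_trans (probability_le1 _ _)) ?ltry//;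
       apply: measurableI => //; apply: mpre.
  move=> A mA; rewrite /= /pushforward /mrestr /mscale /= -rE muleC.
  exact: window_box.
have [r rE] := law_mscale mE; rewrite rE setIC.
pose m1 := image_measure (mrestr P (@mpre 0 k _ mE)) (@measurable_window k n).
pose m2 : {measure set (n.-tuple S) -> \bar R} := mscale r (iid_law Q n).
suff : m1 F = m2 F by [].
apply: tuple_measure_unique => //.
  by rewrite /= /pushforward /= (le_lt_trans (probability_le1 _ _)) ?ltry//;
     apply: measurableI => //; apply: mpre.
move=> A mA; rewrite /= /pushforward /mrestr /mscale /= -rE setIC.
exact: box_left.
Qed.

Lemma window_law k n (E : set (n.-tuple S)) : measurable E ->
  P (window k n @^-1` E) = iid_law Q n E.
Proof.
move=> mE; have := windows_independent (k := k) measurableT mE.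
by rewrite preimage_setT setTI [X in _ = X * _]probability_setT mul1e.
Qed.

End iid_vectors.

Section reflection.
Context {R : realType}.
Local Open Scope ereal_scope.
Variable Q : probability R R.
Hypothesis Qsym : forall A : set R, measurable A -> Q (-%R @^-1` A) = Q A.

(** Reading a path backwards and changing signs turns the part of a path before its
first minimum into a path that stays positive. *)
Definition rev_opp n (y : n.-tuple R) : n.-tuple R :=
  [tuple (- tnth y (rev_ord i))%R | i < n].

Lemma measurable_rev_opp n : measurable_fun setT (@rev_opp n).
Proof.
apply/measurable_fun_tnthP => i.
rewrite (_ : _ \o _ = fun y => - tnth y (rev_ord i))%R.
  by apply: measurable_funN; exact: measurable_tnth.
by apply/funext => y /=; rewrite tnth_mktuple.
Qed.

Lemma iid_law_rev_opp n (E : set (n.-tuple R)) : measurable E ->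
  iid_law Q n (@rev_opp n @^-1` E) = iid_law Q n E.
Proof.
apply: (tuple_measure_unique
  (m1 := image_measure (iid_law Q n) (@measurable_rev_opp n))).
  by rewrite /= /pushforward preimage_setT [ltLHS]probability_setT ltry.
move=> A mA; rewrite /= /pushforward.
have mN i : measurable (-%R @^-1` A i).
  have mN : measurable_fun [set: R] -%R by exact: measurable_funN.
  by have := mN measurableT _ (mA i); rewrite setTI.
rewrite (_ : _ @^-1` _ = box (fun i => -%R @^-1` A (rev_ord i))).
  rewrite !iid_law_box// (reindex_inj rev_ord_inj).
  by apply: eq_bigr => i _; rewrite /= rev_ordK Qsym.
apply/seteqP; split => y /= Ay i _ /=.
  by have := Ay (rev_ord i) I; rewrite /= tnth_mktuple rev_ordK.
by rewrite tnth_mktuple; have := Ay (rev_ord i) I; rewrite /= rev_ordK.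
Qed.

End reflection.

(** * Sequences with constant self-convolution; first minimum of a path *)

Section self_convolution.
Context {R : realType}.
Variable a : nat -> R.
Hypothesis a_ge0 : forall n, 0 <= a n.
Hypothesis a_noninc : forall m n, (m <= n)%N -> a n <= a m.
Hypothesis a_conv : forall n, \sum_(k < n.+1) a k * a (n - k)%N = 1.

Local Notation A n := (\sum_(k < n) a k).

Let A_ge0 n : 0 <= A n. Proof. exact: sumr_ge0. Qed.

Let A_le m n : (m <= n)%N -> A m <= A n.
Proof.
move=> /subnKC <-; rewrite big_split_ord /= lerDl; exact: sumr_ge0.
Qed.

Let triangular n : \sum_(k < n) a k * A (n - k)%N = n%:R.
Proof.
elim: n => [|n IHn]; first by rewrite big_ord0.
transitivity (\sum_(k < n.+1) (a k * A (n - k)%N + a k * a (n - k)%N)).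
  apply: eq_bigr => k _.
  by rewrite subSn -1?ltnS// big_ord_recr /= mulrDr.
rewrite big_split /= a_conv big_ord_recr /= subnn big_ord0 mulr0 addr0 IHn.
by rewrite natr1.
Qed.

(** The triangle i + j < n, over which the sum of a_i a_j is n, is contained in the
square of side n. *)
Lemma self_convolution_sum_ge n : Num.sqrt n%:R <= A n.
Proof.
rewrite -(ler_pXn2r (ltn0Sn 1)) ?nnegrE ?sqrtr_ge0// sqr_sqrtr//.
rewrite -triangular expr2 mulr_suml; apply: ler_sum => k _.
by rewrite ler_wpM2l// A_le// leq_subr.
Qed.

(** The square of side n is contained in the triangle i + j < 2 n. *)
Lemma self_convolution_sum_le n : A n <= Num.sqrt (2 * n%:R).
Proof.
rewrite -(ler_pXn2r (ltn0Sn 1)) ?nnegrE ?sqrtr_ge0// sqr_sqrtr ?mulr_ge0//.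
rewrite -natrM -triangular mul2n -addnn big_split_ord /=.
apply: ler_wpDr; first by apply: sumr_ge0 => k _; rewrite mulr_ge0 ?A_ge0.
rewrite expr2 mulr_suml; apply: ler_sum => k _.
by rewrite ler_wpM2l//; apply: A_le; rewrite -addnBA ?leq_addr// ltnW.
Qed.

Lemma self_convolution_le n : n%:R * a n <= Num.sqrt (2 * n%:R).
Proof.
apply: le_trans (self_convolution_sum_le n).
rewrite mulr_natl -[X in a n *+ X](card_ord n) -sumr_const.
by apply: ler_sum => k _; apply: a_noninc; exact: ltnW.
Qed.

(** The partial sum up to 8 n is at least twice the bound on the partial sum up
to n, and the terms in between are at most a_n. *)
Lemma self_convolution_ge n : Num.sqrt (2 * n%:R) <= 7 * n%:R * a n.
Proof.
have h : A (n + 7 * n)%N <= Num.sqrt (2 * n%:R) + 7 * n%:R * a n.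
  rewrite big_split_ord /= lerD ?self_convolution_sum_le//.
  rewrite -natrM mulr_natl -[X in a n *+ X](card_ord (7 * n)) -sumr_const.
  by apply: ler_sum => k _; apply: a_noninc; exact: leq_addr.
have := le_trans (self_convolution_sum_ge _) h.
have -> : (n + 7 * n)%:R = 2 ^+ 2 * (2 * n%:R) :> R by rewrite natrD natrM; ring.
by rewrite (@sqrtrM _ (2 ^+ 2)) ?exprn_ge0// sqrtr_sqr ger0_norm//; lra.
Qed.

End self_convolution.

Section first_minimum.
Context {R : realType}.
Implicit Type y : nat -> R.

Definition stays_positive n y := forall k, (k < n)%N -> 0 < \sum_(i < k.+1) y i.
Definition stays_nonneg n y := forall k, (k < n)%N -> 0 <= \sum_(i < k.+1) y i.

(** k is the first index in 0, ..., n at which the partial sums of y are minimal,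
see [first_minimumP]. The condition after k is phrased through the shifted sequence,
as this is the part of the path that is independent of the past of k. *)
Definition first_minimum n y k :=
  (forall j, (j < k)%N -> \sum_(i < k) y i < \sum_(i < j) y i) /\
  stays_nonneg (n - k) (fun i => y (k + i)%N).

Lemma first_minimumP n y k : (k <= n)%N -> first_minimum n y k <->
  (forall j, (j < k)%N -> \sum_(i < k) y i < \sum_(i < j) y i) /\
  (forall j, (k < j <= n)%N -> \sum_(i < k) y i <= \sum_(i < j) y i).
Proof.
move=> kn; rewrite /first_minimum /stays_nonneg; split=> -[yk ky]; split=> //.
  move=> j /andP[kj jn].
  have jnk : (j - k.+1 < n - k)%N by lia.
  have := ky _ jnk; rewrite -subSn// subSS.
  suff -> : \sum_(i < j) y i = \sum_(i < k + (j - k)) y i.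
    by rewrite big_split_ord /= lerDl.
  by rewrite subnKC// ltnW.
move=> j jnk; have kjn : (k < k + j.+1 <= n)%N by lia.
by have := ky _ kjn; rewrite big_split_ord /= lerDl.
Qed.

Lemma first_minimum_exists n y : exists2 k, (k <= n)%N & first_minimum n y k.
Proof.
pose S j := \sum_(i < j) y i.
pose p k := (k <= n)%N && [forall j : 'I_n.+1, S k <= S j].
have [k /andP[kn /forallP kmin] kfirst] : {k | p k & forall j, p j -> (k <= j)%N}.
  suff /ex_minnP[k] : exists k, p k by exists k.
  pose k := [arg min_(j < (ord0 : 'I_n.+1)) S j]%O.
  exists k; rewrite /p -ltnS ltn_ord; apply/forallP => j.
  by rewrite /k; case: arg_minP => //= i _; exact.
exists k => //; apply/first_minimumP => //; split=> [j jk|j /andP[kj jn]].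
  rewrite ltNge; apply/negP => Sjk.
  suff /kfirst : p j by rewrite leqNgt jk.
  rewrite /p (leq_trans (ltnW jk))//=; apply/forallP => i.
  exact: le_trans Sjk (kmin i).
exact: (kmin (Ordinal (jn : (j < n.+1)%N))).
Qed.

Lemma first_minimum_uniq n y k l : (k <= n)%N -> (l <= n)%N ->
  first_minimum n y k -> first_minimum n y l -> k = l.
Proof.
wlog kl : k l / (k <= l)%N.
  by move=> H; have [/H//|/ltnW lk] := leqP k l => *; apply/esym; exact: H.
move=> kn ln /first_minimumP -/(_ kn)[_ yk] /first_minimumP -/(_ ln)[yl _].
move: kl; rewrite leq_eqVlt => /predU1P[//|kl].
have := yk l; rewrite kl ln => /(_ isT).
by rewrite leNgt yl.
Qed.

End first_minimum.

(** * Persistence of a symmetric random walk *)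

Section ae_measure.
Context {d : measure_display} {T : measurableType d} {R : realType}.
Variable P : {measure set T -> \bar R}.

Lemma ae_le_measure (A B : set T) : measurable A -> measurable B ->
  {ae P, forall w, A w -> B w} -> (P A <= P B)%E.
Proof.
move=> mA mB [N [mN N0 AB]].
rewrite -(measureU0 mB mN N0); apply: le_measure.
- by rewrite inE.
- by rewrite inE; exact: measurableU.
move=> w Aw; have [Bw|nBw] := pselect (B w); [by left|right].
by apply: AB => /= H; exact/nBw/H.
Qed.

Lemma ae_eq_measure (A B : set T) : measurable A -> measurable B ->
  {ae P, forall w, A w <-> B w} -> P A = P B.
Proof.
move=> mA mB AB; apply/eqP; rewrite eq_le; apply/andP; split;
  apply: ae_le_measure => //; by apply: filterS AB => w [].
Qed.

End ae_measure.

Section stays_measurable.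
Context {d : measure_display} {T : measurableType d} {R : realType}.
Variable Z : nat -> T -> R.
Hypothesis mZ : forall i, measurable_fun setT (Z i).

Let msum k : measurable_fun setT (fun w => \sum_(i < k) Z i w).
Proof. by apply: measurable_sum => i; exact: mZ. Qed.

Lemma measurable_stays_positive n :
  measurable [set w | stays_positive n (Z ^~ w)].
Proof.
rewrite (_ : mkset _ = \bigcap_(k in `I_n)
    ((fun w => \sum_(i < k.+1) Z i w) @^-1` `]0, +oo[)).
  apply: bigcap_measurableType => k _.
  have := msum k.+1; move=> /(_ measurableT `]0, +oo[%classic).
  by rewrite setTI; apply; exact: measurable_itv.
by apply/seteqP; split => w /= Zw k kn; have := Zw k kn; rewrite /= in_itv /= andbT.
Qed.

Lemma measurable_stays_nonneg n : measurable [set w | stays_nonneg n (Z ^~ w)].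
Proof.
rewrite (_ : mkset _ = \bigcap_(k in `I_n)
    ((fun w => \sum_(i < k.+1) Z i w) @^-1` `[0, +oo[)).
  apply: bigcap_measurableType => k _.
  have := msum k.+1; move=> /(_ measurableT `[0, +oo[%classic).
  by rewrite setTI; apply; exact: measurable_itv.
by apply/seteqP; split => w /= Zw k kn; have := Zw k kn; rewrite /= in_itv /= andbT.
Qed.

End stays_measurable.

Section tuple_stays.
Context {R : realType}.

Definition positive_tuples n : set (n.-tuple R) :=
  [set y | stays_positive n (nth 0 y)].
Definition nonneg_tuples n : set (n.-tuple R) :=
  [set y | stays_nonneg n (nth 0 y)].

Lemma measurable_nth_tuple n i : measurable_fun setT (fun y : n.-tuple R => nth 0 y i).
Proof.
have [ni|ni] := ltnP i n.
  rewrite (_ : (fun _ => _) = fun y : n.-tuple R => tnth y (Ordinal ni)).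
    exact: measurable_tnth.
  by apply/funext => y; rewrite (tnth_nth 0).
rewrite (_ : (fun _ => _) = cst 0); first exact: measurable_cst.
by apply/funext => y; rewrite nth_default// size_tuple.
Qed.

Lemma measurable_positive_tuples n : measurable (@positive_tuples n).
Proof. by apply: measurable_stays_positive; exact: measurable_nth_tuple. Qed.

Lemma measurable_nonneg_tuples n : measurable (@nonneg_tuples n).
Proof. by apply: measurable_stays_nonneg; exact: measurable_nth_tuple. Qed.

Lemma eq_stays_positive n (y z : nat -> R) : (forall i, (i < n)%N -> y i = z i) ->
  stays_positive n y <-> stays_positive n z.
Proof.
move=> yz; have yzE k : (k < n)%N -> \sum_(i < k.+1) y i = \sum_(i < k.+1) z i.
  by move=> kn; apply: eq_bigr => i _; rewrite yz// (leq_trans (ltn_ord i)).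
by split=> H k kn; [rewrite -yzE|rewrite yzE]; rewrite ?H.
Qed.

Lemma eq_stays_nonneg n (y z : nat -> R) : (forall i, (i < n)%N -> y i = z i) ->
  stays_nonneg n y <-> stays_nonneg n z.
Proof.
move=> yz; have yzE k : (k < n)%N -> \sum_(i < k.+1) y i = \sum_(i < k.+1) z i.
  by move=> kn; apply: eq_bigr => i _; rewrite yz// (leq_trans (ltn_ord i)).
by split=> H k kn; [rewrite -yzE|rewrite yzE]; rewrite ?H.
Qed.

(** The partial sums of the reversed and negated path are the differences between
earlier partial sums and the last one. *)
Lemma rev_opp_positive n (y : nat -> R) (t : n.-tuple R) :
  (forall i, (i < n)%N -> nth 0 t i = y i) ->
  positive_tuples (rev_opp t) <->
  forall j, (j < n)%N -> \sum_(i < n) y i < \sum_(i < j) y i.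
Proof.
move=> ty.
have sumE m : (m <= n)%N ->
    \sum_(i < m) nth 0 (rev_opp t) i = \sum_(i < n - m) y i - \sum_(i < n) y i.
  elim: m => [_|m IHm mn]; first by rewrite big_ord0 subn0 subrr.
  rewrite big_ord_recr /= (IHm (ltnW mn)).
  have -> : nth 0 (rev_opp t) m = - y (n - m.+1)%N.
    rewrite -(tnth_nth 0 (rev_opp t) (Ordinal mn)) tnth_mktuple.
    by rewrite (tnth_nth 0) /= ty//; lia.
  have -> : \sum_(i < n - m) y i = \sum_(i < (n - m.+1).+1) y i by rewrite subnSK.
  by rewrite big_ord_recr /=; ring.
split=> H j jn.
  have nj : (n - j.+1 < n)%N by lia.
  have := H _ nj; rewrite -subSn// subSS sumE ?leq_subr// subr_gt0.
  by rewrite subKn// ltnW.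
rewrite sumE// subr_gt0; apply: H; lia.
Qed.

End tuple_stays.

Section persistence.
Context {d : measure_display} {T : measurableType d} {R : realType}.
Variables (P : probability T R) (Q : probability R R) (Y : nat -> T -> R).
Hypothesis mY : forall i, measurable_fun setT (Y i).
Hypothesis Ylaw : forall n (A : 'I_n -> set R), (forall i, measurable (A i)) ->
  P (\bigcap_(i : 'I_n) (Y i @^-1` A i)) = (\prod_(i < n) Q (A i))%E.
Hypothesis Qsym : forall A : set R, measurable A -> Q (-%R @^-1` A) = Q A.
Hypothesis Ynull : forall n, P [set w | \sum_(i < n.+1) Y i w = 0] = 0%E.

Definition persistence n : \bar R := P [set w | stays_positive n (Y ^~ w)].

Lemma nth_window k n i w : (i < n)%N ->
  nth 0 (window Y k n w) i = Y (k + i)%N w.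
Proof.
by move=> ni; rewrite -(tnth_nth 0 (window Y k n w) (Ordinal ni)) tnth_mktuple.
Qed.

Lemma window_positive k n :
  window Y k n @^-1` @positive_tuples R n =
  [set w | stays_positive n (fun i => Y (k + i)%N w)].
Proof.
apply/seteqP; split => w /=; rewrite /positive_tuples /=;
  apply eq_stays_positive => i ni;
  by rewrite nth_window.
Qed.

Lemma window_nonneg k n :
  window Y k n @^-1` @nonneg_tuples R n =
  [set w | stays_nonneg n (fun i => Y (k + i)%N w)].
Proof.
apply/seteqP; split => w /=; rewrite /nonneg_tuples /=;
  apply eq_stays_nonneg => i ni;
  by rewrite nth_window.
Qed.

Lemma persistenceE n : persistence n = iid_law Q n (@positive_tuples R n).
Proof.
rewrite -(window_law mY Ylaw 0); last exact: measurable_positive_tuples.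
by rewrite window_positive.
Qed.

Let nonnegE n : iid_law Q n (@nonneg_tuples R n) = persistence n.
Proof.
rewrite -(window_law mY Ylaw 0); last exact: measurable_nonneg_tuples.
rewrite window_nonneg; apply: ae_eq_measure.
- exact: measurable_stays_nonneg.
- exact: measurable_stays_positive.
have : {ae P, forall w, forall k, \sum_(i < k.+1) Y i w != 0}.
  apply/ae_foralln => k.
  exists [set w | \sum_(i < k.+1) Y i w = 0]; split.
  - have : measurable_fun setT (fun w => \sum_(i < k.+1) Y i w).
      by apply: measurable_sum => i; exact: mY.
    by move=> /(_ measurableT [set 0] (measurable_set1 _)); rewrite setTI.
  - exact: Ynull.
  - by move=> w /= /negP; rewrite negbK => /eqP.
apply: filterS => w Yw; split=> H k kn.
  by rewrite lt_neqAle eq_sym Yw; exact: H.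
by apply: ltW; exact: H.
Qed.

(** The events that the first minimum is at k, for k = 0, ..., n, partition the
space. Each of them is the intersection of two independent events: before k the
reversed and negated path stays positive, which has the probability of
persistence k because Q is symmetric; after k the path stays nonnegative, which
has the probability of persistence (n - k) because ties are negligible. *)
Lemma persistence_conv n :
  (\sum_(k < n.+1) persistence k * persistence (n - k)%N = 1)%E.
Proof.
pose D k := [set w | first_minimum n (Y ^~ w) k].
have DE k : (k <= n)%N ->
    D k = window Y 0 k @^-1` (@rev_opp _ k @^-1` @positive_tuples R k)
    `&` window Y k (n - k) @^-1` @nonneg_tuples R (n - k).
  move=> kn; rewrite window_nonneg; apply/seteqP; split => w.
    move=> [D1 D2]; split => //=.
    apply/(rev_opp_positive (y := Y ^~ w)) => // i ik.
    by rewrite nth_window.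
  move=> [D1 D2]; split => //.
  apply/(rev_opp_positive (y := Y ^~ w) (t := window Y 0 k w)) => // i ik.
  by rewrite nth_window.
have mrev k : measurable (@rev_opp _ k @^-1` @positive_tuples R k).
  by have := @measurable_rev_opp R k measurableT _ (@measurable_positive_tuples R k);
    rewrite setTI.
have mD (k : 'I_n.+1) : measurable (D k).
  rewrite DE; last by rewrite -ltnS.
  apply: measurableI.
    by have := @measurable_window _ _ _ _ Y mY 0 k measurableT _ (mrev k); rewrite setTI.
  have := @measurable_window _ _ _ _ Y mY k (n - k) measurableT _
    (@measurable_nonneg_tuples R (n - k)%N).
  by rewrite setTI.
transitivity (\sum_(k < n.+1) P (D k))%E.
  apply: eq_bigr => k _; have kn : (k <= n)%N by rewrite -ltnS.
  rewrite DE// (windows_independent mY Ylaw)//; last exact: measurable_nonneg_tuples.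
  rewrite (iid_law_rev_opp Qsym)//; last exact: measurable_positive_tuples.
  by rewrite nonnegE persistenceE.
rewrite -(measure_bigsetU_ord P xpredT mD); last first.
  move=> i j _ _ [w [Di Dj]]; apply: val_inj.
  by apply: (first_minimum_uniq _ _ Di Dj); rewrite -ltnS.
rewrite -(probability_setT P); congr (P _); apply/seteqP; split=> // w _.
have [k kn Dk] := first_minimum_exists n (Y ^~ w).
rewrite -bigcup_seq; exists (inord k); first by rewrite /= mem_index_enum.
by rewrite /= inordK.
Qed.

End persistence.

(** * The random walk embedded in Brownian motion *)

Section brownian_walk.
Context {d : measure_display} {T : measurableType d} {R : realType}.
Variables (P : probability T R) (B : R -> {mfun T >-> R}).
Hypothesis B_bm : brownian_motion P B.
Variable t : R.
Hypothesis t_gt0 : 0 < t.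

Definition increment (i : nat) (w : T) : R := B (i.+1%:R * t) w - B (i%:R * t) w.

Lemma measurable_increment i : measurable_fun setT (increment i).
Proof. exact: measurable_funB. Qed.

Lemma sum_increment n w :
  \sum_(i < n) increment i w = B (n%:R * t) w - B 0 w.
Proof.
elim: n => [|n IHn]; first by rewrite big_ord0 mul0r subrr.
by rewrite big_ord_recr /= IHn /increment; ring.
Qed.

Let Q := centered_normal (Num.sqrt t).

Let st_neq0 : Num.sqrt t != 0. Proof. by rewrite gt_eqF// sqrtr_gt0. Qed.

Lemma increment_law n (A : 'I_n -> set R) : (forall i, measurable (A i)) ->
  P (\bigcap_(i : 'I_n) (increment i @^-1` A i)) =
  (\prod_(i < n) centered_normal (Num.sqrt t) (A i))%E.
Proof.
move=> mA.
have := bm_indep B_bm (n := n) (t := fun i => i%:R * t).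
rewrite mul0r => /(_ (lexx 0)) -> //; last first.
  by move=> i _; rewrite ler_wpM2r ?ler_nat// ltW.
apply: eq_bigr => i _.
have it0 : 0 <= i%:R * t by rewrite mulr_ge0// ltW.
have iit : i%:R * t < i.+1%:R * t by rewrite ltr_pM2r// ltr_nat.
rewrite [in RHS](_ : t = i.+1%:R * t - i%:R * t); last by rewrite -natr1; ring.
exact: (bm_gaussian B_bm it0 iit (mA i)).
Qed.

Lemma increment_sum_null n (c : R) :
  P [set w | \sum_(i < n.+1) increment i w = c] = 0%E.
Proof.
have nt0 : 0 < n.+1%:R * t by rewrite mulr_gt0.
rewrite -(normal_prob_set1 0 (Num.sqrt (n.+1%:R * t - 0)) c).
rewrite -(bm_gaussian B_bm (lexx 0) nt0 (measurable_set1 c)).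
by congr (P _); apply/seteqP; split => w /=; rewrite sum_increment.
Qed.

(** The increments of X on the grid, divided by sigma, when c = mu * t / sigma. *)
Definition drifted (c : R) (i : nat) (w : T) : R := increment i w + c.

Lemma measurable_drifted c i : measurable_fun setT (drifted c i).
Proof. by apply: measurable_funD => //; exact: measurable_increment. Qed.

Lemma sum_drifted c n w :
  \sum_(i < n) drifted c i w = \sum_(i < n) increment i w + n%:R * c.
Proof. by rewrite big_split /= sumr_const card_ord mulr_natl. Qed.

Definition survival (c : R) (n : nat) : R := fine (persistence P (drifted c) n).

Lemma survivalE c n : (survival c n)%:E = persistence P (drifted c) n.
Proof.
rewrite /survival fineK// /persistence fin_num_measure//.
by apply: measurable_stays_positive; exact: measurable_drifted.
Qed.

Lemma survival_ge0 c n : 0 <= survival c n.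
Proof. by rewrite -lee_fin survivalE measure_ge0. Qed.

Lemma survival_noninc c m n : (m <= n)%N -> survival c n <= survival c m.
Proof.
move=> mn; rewrite -lee_fin !survivalE /persistence; apply: le_measure.
- by rewrite inE; apply: measurable_stays_positive; exact: measurable_drifted.
- by rewrite inE; apply: measurable_stays_positive; exact: measurable_drifted.
- by move=> w H k km; apply: H; exact: leq_trans km mn.
Qed.

Lemma survival_le_drift b c n : b <= c -> survival b n <= survival c n.
Proof.
move=> bc; rewrite -lee_fin !survivalE /persistence; apply: le_measure.
- by rewrite inE; apply: measurable_stays_positive; exact: measurable_drifted.
- by rewrite inE; apply: measurable_stays_positive; exact: measurable_drifted.
- move=> w /= H k kn; apply: lt_le_trans (H _ kn) _.
  by apply: ler_sum => i _; rewrite lerD2l.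
Qed.

Let persistence_drifted c n : persistence P (drifted c) n =
  iid_law Q n (map_tuple (+%R^~ c) @^-1` @positive_tuples R n).
Proof.
have mE : measurable (map_tuple (+%R^~ c) @^-1` @positive_tuples R n).
  by have := @measurable_map_shift R n c measurableT _ (@measurable_positive_tuples R n);
    rewrite setTI.
rewrite -(window_law (P := P) (Q := Q) measurable_increment increment_law 0 mE).
congr (P _); apply/seteqP; split => w;
  apply eq_stays_positive => i ni;
  rewrite -[nth 0 _ i]/(nth 0 _ (Ordinal ni)) -tnth_nth tnth_map tnth_mktuple//.
Qed.

Lemma survival_conv n : \sum_(k < n.+1) survival 0 k * survival 0 (n - k)%N = 1.
Proof.
apply: EFin_inj; rewrite -sumEFin.
under eq_bigr do rewrite EFinM !survivalE.
apply: (persistence_conv (Q := Q)).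
- exact: measurable_drifted.
- move=> m A mA; rewrite -[RHS](increment_law mA); congr (P _).
  by apply: eq_bigcapr => i _; rewrite /drifted/=; under eq_fun do rewrite addr0.
- by move=> A mA; apply: normal_opp => //.
- move=> m; rewrite -(increment_sum_null m 0); congr (P _).
  by apply/seteqP; split => w /=; rewrite sum_drifted mulr0 addr0.
Qed.

(** The variance of an increment is t, so that over n steps the fourth moment of
the likelihood ratio depends on n * c^2 / t only. For c proportional to t this
is proportional to the elapsed time n * t. *)
Lemma survival_shift_le (b c K : R) n : 0 < K ->
  survival (b + c) n <=
  K * survival b n + expR (6 * c ^+ 2 / t) ^+ n / K ^+ 3.
Proof.
move=> K0; rewrite -lee_fin EFinD EFinM !survivalE !persistence_drifted.
have mE : measurable (map_tuple (+%R^~ b) @^-1` @positive_tuples R n).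
  by have := @measurable_map_shift R n b measurableT _ (@measurable_positive_tuples R n);
    rewrite setTI.
have := @iid_law_shift_le R (Num.sqrt t) c K n _ st_neq0 K0 mE.
rewrite sqr_sqrtr ?(ltW t_gt0)//; apply: le_trans.
rewrite le_eqVlt; apply/orP; left; apply/eqP; congr (iid_law Q n _).
apply/seteqP; split => y /=;
  rewrite (_ : map_tuple (+%R^~ b) (map_tuple (+%R^~ c) y) =
               map_tuple (+%R^~ (b + c)) y)//;
  by apply: eq_from_tnth => i; rewrite !tnth_map; ring.
Qed.

End brownian_walk.

(** * Discounted grid hitting times *)

Section discount.
Context {R : realType}.
Implicit Types (r : R) (u v : \bar R).

Lemma discount_if r u : 0 < r ->
  discount r u = if u \is a fin_num then expR (- (r * fine u)) else 0.
Proof.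
move=> r0; rewrite /discount; case: u => [u| |] //=.
- by rewrite gt0_muley ?lte_fin.
- by rewrite gt0_muleNy ?lte_fin.
Qed.

Lemma discount_ge0 r u : 0 < r -> 0 <= discount r u.
Proof. by move=> r0; rewrite discount_if//; case: ifP => // _; exact: expR_ge0. Qed.

Lemma discount_EFin r x : discount r x%:E = expR (- (r * x)).
Proof. by []. Qed.

Lemma discount_noninc r u v : 0 < r -> (0 <= u)%E -> (u <= v)%E ->
  discount r v <= discount r u.
Proof.
move=> r0; case: v => [v| |]; case: u => [u| |]//= u0 uv.
- by rewrite !discount_EFin ler_expR lerN2 ler_pM2l.
- by rewrite [leLHS]discount_if//= discount_ge0.
Qed.

Lemma measurable_discount r : 0 < r -> measurable_fun setT (discount r).
Proof.
move=> r0; rewrite (_ : discount r =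
    fun u => if u \is a fin_num then expR (- (r * fine u)) else 0); last first.
  by apply/funext => u; exact: discount_if.
apply: measurable_fun_ifT => //=.
  by apply: (measurable_fun_bool true); exact/emeasurable_fin_num.
apply: measurableT_comp => //; apply: measurable_funN.
exact: measurable_funM.
Qed.

End discount.

Section hitting.
Context {R : realType} {T : Type}.
Variables (X : R -> T -> R) (G : set R) (r t : R).
Hypotheses (r_gt0 : 0 < r) (t_gt0 : 0 < t).
Local Notation tau := (grid_hitting_time X G t).

(** The event that the hitting time exceeds n * t. *)
Definition avoids n : set T :=
  [set w | forall j, (j < n)%N -> ~ G (X (j.+1%:R * t) w)].

Let tau_ge n w : avoids n w -> ((n%:R * t)%:E <= tau w)%E.
Proof.
move=> wn; apply: le_ereal_inf_tmp => _ [u [[[//|k] k0 ->] Gu] <-].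
rewrite lee_fin ler_pM2r// ler_nat ltnW// ltnS leqNgt; apply/negP => kn.
exact: wn Gu.
Qed.

Let tau_ge0 w : (0 <= tau w)%E.
Proof. by have := @tau_ge 0 w; rewrite mul0r; exact. Qed.

Let tau_le n w : G (X (n.+1%:R * t) w) -> (tau w <= (n.+1%:R * t)%:E)%E.
Proof.
move=> Gn; apply: ereal_inf_lbound; exists (n.+1%:R * t) => //.
by split => //; exists n.+1.
Qed.

Definition discount_loss w : R := 1 - discount r (tau w).

Lemma discount_loss_ge0 w : 0 <= discount_loss w.
Proof.
rewrite subr_ge0 -[leRHS]expR0 -[0]oppr0 -(mulr0 r) -discount_EFin.
exact: discount_noninc.
Qed.

Lemma discount_loss_le1 w : discount_loss w <= 1.
Proof. by rewrite gerBl discount_ge0. Qed.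

Lemma discount_loss_ge n w :
  (1 - expR (- (r * (n%:R * t)))) * \1_(avoids n) w <= discount_loss w.
Proof.
rewrite indicE; have [wn|_] := boolP (w \in avoids n); last first.
  by rewrite mulr0 discount_loss_ge0.
rewrite mulr1 lerB// -discount_EFin discount_noninc//.
  by rewrite lee_fin mulr_ge0// ltW.
by apply: tau_ge; rewrite inE in wn.
Qed.

(** If the hitting time is (k + 1) * t with k < n, then the loss is at most
r * (k + 1) * t, and the k + 1 events avoids 0, ..., avoids k all hold;
otherwise avoids n holds, and the loss is at most 1. *)
Lemma discount_loss_le n w :
  discount_loss w <= r * t * (\sum_(k < n) \1_(avoids k) w) + \1_(avoids n) w.
Proof.
have [wn|wn] := pselect (avoids n w).
  rewrite [X in _ <= _ + X]indicE mem_set// ler_wpDl ?discount_loss_le1//.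
  by rewrite mulr_ge0 ?sumr_ge0// mulr_ge0// ltW.
have [k kn [Gk kmin]] : exists2 k, (k < n)%N & G (X (k.+1%:R * t) w) /\
    forall j, (j < k)%N -> ~ G (X (j.+1%:R * t) w).
  have exk : exists k, `[< G (X (k.+1%:R * t) w) >] && (k < n)%N.
    apply: contrapT => /forallNP nG; apply: wn => j jn Gj.
    by apply: (nG j); rewrite jn andbT; exact/asboolP.
  case: (ex_minnP exk) => k /andP[/asboolP Gk kn] kmin; exists k => //; split => //.
  move=> j jk Gj; suff : (k <= j)%N by rewrite leqNgt jk.
  by apply: kmin; rewrite (ltn_trans jk kn) andbT; exact/asboolP.
have tk := tau_le Gk.
apply: (@le_trans _ _ (r * t * k.+1%:R)).
  have : expR (- (r * (k.+1%:R * t))) <= discount r (tau w).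
    by rewrite -discount_EFin discount_noninc.
  have := expR_ge1Dx (- (r * (k.+1%:R * t))).
  by rewrite /discount_loss; lra.
apply: ler_wpDr => //; rewrite ler_wpM2l//; first by rewrite mulr_ge0// ltW.
rewrite -(subnKC kn) big_split_ord /= ler_wpDr//; first exact: sumr_ge0.
rewrite -[X in X%:R](card_ord k.+1) -sumr_const; apply: ler_sum => i _.
rewrite indicE mem_set// => j ji; apply: kmin.
by rewrite (leq_trans ji)// -ltnS.
Qed.

End hitting.

Section hitting_measurable.
Context {d : measure_display} {T : measurableType d} {R : realType}.
Variables (X : R -> {mfun T >-> R}) (G : set R) (r t : R).
Hypotheses (r_gt0 : 0 < r) (t_gt0 : 0 < t) (mG : measurable G).

Let mX (u : R) : measurable (X u @^-1` G).
Proof. by rewrite -[_ @^-1` _]setTI; exact: measurable_funP. Qed.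

Lemma measurable_avoids n : measurable (avoids X G t n).
Proof.
rewrite (_ : avoids _ _ _ _ = \bigcap_(j in `I_n) ~` (X (j.+1%:R * t) @^-1` G)).
  by apply: bigcap_measurableType => j _; apply: measurableC; exact: mX.
by apply/seteqP; split => w.
Qed.

Lemma measurable_grid_hitting_time :
  measurable_fun setT (grid_hitting_time X G t).
Proof.
pose h k w : \bar R := if w \in X (k.+1%:R * t) @^-1` G then (k.+1%:R * t)%:E else +oo%E.
have mh k : measurable_fun setT (h k).
  apply: measurable_fun_ifT => //; apply: (measurable_fun_bool true).
  rewrite setTI (_ : _ @^-1` _ = X (k.+1%:R * t) @^-1` G) //.
  by apply/seteqP; split => w; [exact: set_mem|exact: mem_set].
rewrite (_ : grid_hitting_time X G t = fun w => einfs (h ^~ w) 0%N).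
  exact: measurable_fun_einfs.
apply/funext => w; apply/eqP; rewrite eq_le; apply/andP; split.
  apply: le_ereal_inf_tmp => _ [k _ <-]; rewrite /h.
  case: ifPn => [/set_mem Gk|_]; last exact: leey.
  by apply: ereal_inf_lbound; exists (k.+1%:R * t) => //; split => //; exists k.+1.
apply: le_ereal_inf_tmp => _ [u [[[//|k] _ ->] Gk] <-].
apply: ereal_inf_lbound; exists k => //.
by rewrite /h mem_set.
Qed.

Lemma measurable_discount_loss : measurable_fun setT (discount_loss X G r t).
Proof.
apply: measurable_funB => //.
exact: (measurableT_comp (measurable_discount r_gt0) measurable_grid_hitting_time).
Qed.

Variable P : probability T R.

Definition expected_loss : R := fine (\int[P]_w (discount_loss X G r t w)%:E).

Let int_le1 : (\int[P]_w (discount_loss X G r t w)%:E <= 1)%E.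
Proof.
rewrite -(probability_setT P) -[leRHS]mul1e -integral_cst//.
apply: ge0_le_integral => //.
- by move=> w _; rewrite lee_fin discount_loss_ge0.
- exact/measurable_EFinP/measurable_discount_loss.
- by move=> w _; rewrite lee_fin discount_loss_le1.
Qed.

Let int_ge0 : (0 <= \int[P]_w (discount_loss X G r t w)%:E)%E.
Proof. by apply: integral_ge0 => w _; rewrite lee_fin discount_loss_ge0. Qed.

Lemma expected_lossE : (expected_loss%:E = \int[P]_w (discount_loss X G r t w)%:E)%E.
Proof.
by rewrite /expected_loss fineK// ge0_fin_numE// (le_lt_trans int_le1)// ltry.
Qed.

Lemma expected_loss_ge0 : 0 <= expected_loss.
Proof. by rewrite -lee_fin expected_lossE. Qed.

Lemma integrable_discount_loss : P.-integrable setT (EFin \o discount_loss X G r t).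
Proof.
apply/integrableP; split; first exact/measurable_EFinP/measurable_discount_loss.
under eq_integral do rewrite /= ger0_norm ?discount_loss_ge0//.
by rewrite (le_lt_trans int_le1)// ltry.
Qed.

Variable u : nat -> R.
Hypothesis uE : forall n, P (avoids X G t n) = (u n)%:E.

Lemma expected_loss_ge n : (1 - expR (- (r * (n%:R * t)))) * u n <= expected_loss.
Proof.
have a0 : 0 <= 1 - expR (- (r * (n%:R * t))).
  by rewrite subr_ge0 -[leRHS]expR0 ler_expR oppr_le0 !mulr_ge0// ltW.
rewrite -lee_fin expected_lossE EFinM -uE -[X in P X]setIT -integral_indic//; last first.
  exact: measurable_avoids.
have mI : measurable_fun setT (\1_(avoids X G t n) : T -> R).
  by apply: measurable_indic; exact: measurable_avoids.
rewrite -ge0_integralZl//; last exact/measurable_EFinP.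
apply: ge0_le_integral => //.
- by move=> w _; rewrite -EFinM lee_fin mulr_ge0.
- by apply/measurable_EFinP/measurable_funM.
- exact/measurable_EFinP/measurable_discount_loss.
- by move=> w _; rewrite -EFinM lee_fin discount_loss_ge.
Qed.

Lemma expected_loss_le n : expected_loss <= r * t * (\sum_(k < n) u k) + u n.
Proof.
have mI k : measurable_fun setT (\1_(avoids X G t k) : T -> R).
  by apply: measurable_indic; exact: measurable_avoids.
have intI k : (\int[P]_w (\1_(avoids X G t k) w)%:E = (u k)%:E)%E.
  by rewrite integral_indic//; [rewrite setIT; exact: uE|exact: measurable_avoids].
have rt0 : 0 <= r * t by rewrite mulr_ge0// ltW.
rewrite -lee_fin expected_lossE EFinD EFinM -sumEFin.
apply: (@le_trans _ _ (\int[P]_w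
    ((r * t)%:E * (\sum_(k < n) (\1_(avoids X G t k) w)%:E) +
     (\1_(avoids X G t n) w)%:E))%E).
  apply: ge0_le_integral => //.
  - by move=> w _; rewrite lee_fin discount_loss_ge0.
  - exact/measurable_EFinP/measurable_discount_loss.
  - apply: emeasurable_funD; last exact/measurable_EFinP.
    apply: emeasurable_funM => //; apply: emeasurable_sum => k.
    exact/measurable_EFinP.
  - by move=> w _; rewrite sumEFin -EFinM -EFinD lee_fin; exact: discount_loss_le.
rewrite ge0_integralD//; last 3 first.
- by move=> w _; rewrite mule_ge0// sume_ge0.
- apply: emeasurable_funM => //; apply: emeasurable_sum => k.
  exact/measurable_EFinP.
- exact/measurable_EFinP.
rewrite intI leeD2r// ge0_integralZl//; last 2 first.
- by apply: emeasurable_sum => k; exact/measurable_EFinP.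
- by move=> w _; rewrite sume_ge0.
rewrite ge0_integral_sum//; last by move=> k; exact/measurable_EFinP.
by under eq_bigr do rewrite intI.
Qed.

End hitting_measurable.

(** * Survival probabilities in the Black-Scholes model *)

Section step_count.
Context {R : realType}.
Variable s : R.
Hypothesis s01 : 0 < s < 1.

(** The number of grid points in a unit of time, up to which all survival
probabilities are compared. *)
Definition unit_steps : nat := Num.truncn s^-1.

Let s_gt0 : 0 < s. Proof. by case/andP: s01. Qed.

Lemma unit_steps_gt0 : (0 < unit_steps)%N.
Proof. by rewrite truncn_gt_nat invf_ge1// ltW//; case/andP: s01. Qed.

Lemma unit_steps_le : unit_steps%:R * s <= 1.
Proof. by rewrite -ler_pdivlMr// div1r truncn_le invr_ge0 ltW. Qed.

Lemma unit_steps_ge : 2^-1 <= unit_steps%:R * s.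
Proof.
have Ms : 1 < unit_steps%:R * s + s.
  have : s^-1 * s < unit_steps.+1%:R * s by rewrite ltr_pM2r// truncnS_gt.
  by rewrite mulVf ?gt_eqF// -natr1 mulrDl mul1r.
have sM : s <= unit_steps%:R * s.
  by rewrite ler_peMl ?(ltW s_gt0)// (ler_nat _ 1) unit_steps_gt0.
lra.
Qed.

End step_count.

Section black_scholes.
Context {d : measure_display} {T : measurableType d} {R : realType}.
Variables (P : probability T R) (X B : R -> {mfun T >-> R}).
Variables (r sigma gamma mu : R) (G : set R).
Hypotheses (r_gt0 : 0 < r) (sigma_gt0 : 0 < sigma).
Hypothesis GE : G = `]-oo, gamma]%classic \/ G = `]-oo, gamma[%classic.
Hypothesis B_bm : brownian_motion P B.
Hypothesis X_start : {ae P, forall w, X 0 w = gamma}.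
Hypothesis X_bs : {ae P, forall w, forall t : R, 0 <= t ->
  X t w = X 0 w + sigma * B t w + mu * t}.

Let mG : measurable G.
Proof. by case: GE => ->; exact: measurable_itv. Qed.

Local Notation surv s := (survival P B s (mu * s / sigma)).
Local Notation surv0 s := (survival P B s 0).

(** Outside of a negligible event no partial sum vanishes, and then the strict and
the weak inequality defining the two possible sets G amount to the same. *)
Lemma avoids_survival s n : 0 < s -> P (avoids X G s n) = (surv s n)%:E.
Proof.
move=> s0; rewrite survivalE; apply: ae_eq_measure.
- exact: measurable_avoids.
- by apply: measurable_stays_positive; exact: measurable_drifted.
have nosum0 : {ae P, forall w, forall k,
    \sum_(i < k.+1) drifted B s (mu * s / sigma) i w != 0}.
  apply/ae_foralln => k.
  exists [set w | \sum_(i < k.+1) drifted B s (mu * s / sigma) i w = 0]; split.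
  - have : measurable_fun setT
        (fun w => \sum_(i < k.+1) drifted B s (mu * s / sigma) i w).
      by apply: measurable_sum => i; exact: measurable_drifted.
    by move=> /(_ measurableT [set 0] (measurable_set1 _)); rewrite setTI.
  - rewrite -(increment_sum_null B_bm s0 k (- (k.+1%:R * (mu * s / sigma)))).
    congr (P _); apply/seteqP; split => w /=; rewrite sum_drifted => /eqP.
      by rewrite addr_eq0 => /eqP.
    by rewrite -addr_eq0 => /eqP.
  - by move=> w /= /negP; rewrite negbK => /eqP.
apply: filterS2 (filterI X_start X_bs) (filterI nosum0 (bm_start B_bm)).
move=> w [X0 Xw] [nz B0].
have XE j : X (j.+1%:R * s) w - gamma =
    sigma * \sum_(i < j.+1) drifted B s (mu * s / sigma) i w.
  rewrite sum_drifted sum_increment B0 Xw ?X0; last by rewrite mulr_ge0// ltW.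
  by field; rewrite gt_eqF.
have GP j : ~ G (X (j.+1%:R * s) w) <->
    0 < \sum_(i < j.+1) drifted B s (mu * s / sigma) i w.
  rewrite -(pmulr_rgt0 _ sigma_gt0) -XE subr_gt0.
  case: GE => ->; rewrite /= in_itv /=.
    by rewrite ltNge; split => /negP.
  have Xg : gamma != X (j.+1%:R * s) w.
    rewrite eq_sym -subr_eq0 XE mulf_neq0// gt_eqF//.
  rewrite (lt_neqAle gamma) Xg /= leNgt; by split => /negP.
by split=> H j jn; apply/GP; exact: H.
Qed.

Local Notation L s := (expected_loss X G r s P).

(** Bounds the fourth moment of the likelihood ratio over a time at most 1,
uniformly in the mesh of the grid. *)
Definition girsanov_bound : R := expR (6 * (mu / sigma) ^+ 2).

Lemma girsanov_bound_gt0 : 0 < girsanov_bound. Proof. exact: expR_gt0. Qed.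

Lemma shift_bound s n : 0 < s -> n%:R * s <= 1 ->
  expR (6 * (mu * s / sigma) ^+ 2 / s) ^+ n <= girsanov_bound.
Proof.
move=> s0 ns; rewrite -expRM_natl ler_expR.
rewrite (_ : _ * (_ / s) = (n%:R * s) * (6 * (mu / sigma) ^+ 2)); last first.
  by field; rewrite !gt_eqF.
by rewrite ler_piMl// mulr_ge0// sqr_ge0.
Qed.

Lemma surv_le_surv0 s K n : 0 < s -> n%:R * s <= 1 -> 0 < K ->
  surv s n <= K * surv0 s n + girsanov_bound / K ^+ 3.
Proof.
move=> s0 ns K0.
have := survival_shift_le B_bm s0 0 (mu * s / sigma) n K0; rewrite add0r.
move/le_trans; apply; rewrite lerD2l ler_pM2r ?invr_gt0 ?exprn_gt0//.
exact: shift_bound.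
Qed.

Lemma surv0_le_surv s K n : 0 < s -> n%:R * s <= 1 -> 0 < K ->
  surv0 s n <= K * surv s n + girsanov_bound / K ^+ 3.
Proof.
move=> s0 ns K0.
have := survival_shift_le B_bm s0 (mu * s / sigma) (- (mu * s / sigma)) n K0.
rewrite subrr sqrrN.
move/le_trans; apply; rewrite lerD2l ler_pM2r ?invr_gt0 ?exprn_gt0//.
exact: shift_bound.
Qed.

Lemma surv0_ge s : 0 < s < 1 ->
  Num.sqrt s / 7 <= surv0 s (unit_steps s).
Proof.
move=> s01; have /andP[s0 s1] := s01; set M := unit_steps s.
have M0 : 0 < M%:R :> R by rewrite ltr0n unit_steps_gt0.
have := self_convolution_ge (survival_ge0 P B s 0) (survival_noninc P B s 0)
  (survival_conv B_bm s0) M.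
have h : M%:R * Num.sqrt s <= Num.sqrt (2 * M%:R).
  rewrite -(ler_pXn2r (ltn0Sn 1)) ?nnegrE ?mulr_ge0 ?sqrtr_ge0//.
  rewrite exprMn !sqr_sqrtr ?mulr_ge0 ?(ltW s0)// expr2 -mulrA.
  have := unit_steps_le s01; rewrite -/M => Ms; nra.
move=> /(le_trans h).
by rewrite (mulrC 7) -mulrA ler_pM2l// => ?; rewrite ler_pdivrMr// mulrC.
Qed.

Lemma surv0_le s : 0 < s < 1 -> surv0 s (unit_steps s) <= 2 * Num.sqrt s.
Proof.
move=> s01; have /andP[s0 s1] := s01; set M := unit_steps s.
have M0 : 0 < M%:R :> R by rewrite ltr0n unit_steps_gt0.
have := self_convolution_le (survival_ge0 P B s 0) (survival_noninc P B s 0)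
  (survival_conv B_bm s0) M.
have h : Num.sqrt (2 * M%:R) <= M%:R * (2 * Num.sqrt s).
  rewrite -(ler_pXn2r (ltn0Sn 1)) ?nnegrE ?mulr_ge0 ?sqrtr_ge0//.
  rewrite !exprMn !sqr_sqrtr ?mulr_ge0 ?(ltW s0)//.
  have := unit_steps_ge s01; rewrite -/M => Ms; nra.
by move=> /le_trans/(_ h); rewrite ler_pM2l.
Qed.

Lemma surv0_sum_le s : 0 < s < 1 ->
  s * \sum_(k < unit_steps s) surv0 s k <= 2 * Num.sqrt s.
Proof.
move=> s01; have /andP[s0 s1] := s01; set M := unit_steps s.
apply: (@le_trans _ _ (s * Num.sqrt (2 * M%:R))).
  rewrite ler_pM2l//; apply: self_convolution_sum_le.
    exact: survival_ge0.
  exact: survival_conv.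
rewrite -(ler_pXn2r (ltn0Sn 1)) ?nnegrE ?mulr_ge0 ?sqrtr_ge0 ?(ltW s0)//.
rewrite !exprMn !sqr_sqrtr ?mulr_ge0 ?(ltW s0)//.
have := unit_steps_le s01; rewrite -/M => Ms; nra.
Qed.

(** Without drift, s times the sum of the survival probabilities up to time 1 is of
order s^(1/2), and so is the last of them; an affine comparison between
survival probabilities carries over to the expected loss. *)
Lemma expected_loss_le_comparison s K D : 0 < s < 1 -> 0 <= K -> 0 <= D ->
  (forall n, (n <= unit_steps s)%N -> surv s n <= K * surv0 s n + D) ->
  L s <= (r + 1) * (2 * K * Num.sqrt s + D).
Proof.
move=> s01 K0 D0 cmp; have /andP[s0 s1] := s01.
have := expected_loss_le r_gt0 s0 mG (fun n => avoids_survival n s0) (unit_steps s).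
set M := unit_steps s; move=> /le_trans; apply.
have hs : s * \sum_(k < M) surv s k <= K * (2 * Num.sqrt s) + D.
  apply: (@le_trans _ _ (s * (K * \sum_(k < M) surv0 s k + M%:R * D))).
    rewrite ler_pM2l// mulr_sumr -[X in X%:R * D](card_ord M) mulr_natl -sumr_const.
    by rewrite -big_split; apply: ler_sum => k _; apply: cmp; exact: ltnW.
  have -> : s * (K * \sum_(k < M) surv0 s k + M%:R * D) =
      K * (s * \sum_(k < M) surv0 s k) + (M%:R * s) * D by ring.
  rewrite lerD ?ler_wpM2l ?surv0_sum_le//.
  by rewrite ler_piMl// unit_steps_le.
have hM : surv s M <= K * (2 * Num.sqrt s) + D.
  by apply: le_trans (cmp _ (leqnn _)) _; rewrite lerD2r ler_wpM2l// surv0_le.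
rewrite [leRHS](_ : _ =
  r * (K * (2 * Num.sqrt s) + D) + (K * (2 * Num.sqrt s) + D)); last by ring.
by rewrite -mulrA lerD// ler_pM2l.
Qed.

Lemma expected_loss_ge_surv s : 0 < s < 1 ->
  (1 - expR (- (r / 2))) * surv s (unit_steps s) <= L s.
Proof.
move=> s01; have /andP[s0 s1] := s01.
have := expected_loss_ge r_gt0 s0 mG (fun n => avoids_survival n s0) (unit_steps s).
apply: le_trans; rewrite ler_wpM2r ?survival_ge0// lerB// ler_expR lerN2.
by rewrite ler_pM2l// unit_steps_ge.
Qed.

End black_scholes.

(** * Rates for the expected expected_loss *)

Section rates.
Context {d : measure_display} {T : measurableType d} {R : realType}.
Variables (P : probability T R) (X B : R -> {mfun T >-> R}).
Variables (r sigma gamma mu : R) (G : set R).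
Hypotheses (r_gt0 : 0 < r) (sigma_gt0 : 0 < sigma).
Hypothesis GE : G = `]-oo, gamma]%classic \/ G = `]-oo, gamma[%classic.
Hypothesis B_bm : brownian_motion P B.
Hypothesis X_start : {ae P, forall w, X 0 w = gamma}.
Hypothesis X_bs : {ae P, forall w, forall t : R, 0 <= t ->
  X t w = X 0 w + sigma * B t w + mu * t}.

Local Notation L s := (expected_loss X G r s P).
Local Notation D := (girsanov_bound sigma mu).

Let mG : measurable G.
Proof. by case: GE => ->; exact: measurable_itv. Qed.

Let D_gt0 : 0 < D. Proof. exact: girsanov_bound_gt0. Qed.

Lemma expected_loss_le_three_eighths s : 0 < s < 1 ->
  L s <= (r + 1) * (2 + D) * s `^ (3 / 8).
Proof.
move=> s01; have /andP[s0 s1] := s01.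
(* The two terms K * s^(1/2) and K^(-3) are equal for this K. *)
pose K := s `^ (- (1 / 8)).
have K0 : 0 < K by exact: powR_gt0.
have sn0 : s != 0 by rewrite gt_eqF.
have Ks : K * Num.sqrt s = s `^ (3 / 8).
  rewrite -powR12_sqrt ?ltW// -powRD ?sn0 ?implybT//; congr (s `^ _); by field.
have K3 : (K ^+ 3)^-1 = s `^ (3 / 8).
  rewrite -powR_mulrn ?ltW// -powRrM -powRN; congr (s `^ _); by field.
have := @expected_loss_le_comparison _ _ _ P X B r sigma gamma mu G r_gt0 sigma_gt0 GE
  B_bm X_start X_bs s K (D / K ^+ 3) s01 (ltW K0).
rewrite K3 mulr_ge0 ?powR_ge0 ?(ltW D_gt0)// => /(_ isT) H.
apply: le_trans (H _) _; last first.
  by rewrite -(mulrA 2) Ks -mulrA -(mulrDl 2 D).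
move=> n nM; rewrite -K3; apply: surv_le_surv0 => //.
apply: le_trans (unit_steps_le s01).
by rewrite ler_pM2r// ler_nat.
Qed.

Lemma expected_loss_le_sqrt s : mu <= 0 -> 0 < s < 1 -> L s <= 2 * (r + 1) * s `^ (1 / 2).
Proof.
move=> mu0 s01; have /andP[s0 s1] := s01.
have := @expected_loss_le_comparison _ _ _ P X B r sigma gamma mu G r_gt0 sigma_gt0 GE
  B_bm X_start X_bs s 1 0 s01 ler01 (lexx 0).
rewrite div1r powR12_sqrt ?(ltW s0)// => H; apply: le_trans (H _) _; last by lra.
move=> n _; rewrite mul1r addr0; apply: survival_le_drift.
by rewrite pmulr_lle0 ?invr_gt0// pmulr_lle0.
Qed.

Lemma expected_loss_ge_sqrt s : 0 <= mu -> 0 < s < 1 ->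
  (1 - expR (- (r / 2))) / 7 * s `^ (1 / 2) <= L s.
Proof.
move=> mu0 s01; have /andP[s0 s1] := s01.
have r2 : 0 <= 1 - expR (- (r / 2)).
  by rewrite subr_ge0 -[leRHS]expR0 ler_expR oppr_le0 divr_ge0// ltW.
apply: le_trans (expected_loss_ge_surv r_gt0 sigma_gt0 GE B_bm X_start X_bs s01).
rewrite -mulrA ler_wpM2l// mulrC div1r powR12_sqrt ?(ltW s0)//.
apply: le_trans (surv0_ge B_bm s01) _; apply: survival_le_drift.
by rewrite divr_ge0 ?(ltW sigma_gt0)// mulr_ge0// ltW.
Qed.

Lemma expected_loss_ge_two_thirds s : 0 < s < 1 ->
  (1 - expR (- (r / 2))) / (14 * (14 * D) `^ (1 / 3)) * s `^ (2 / 3) <= L s.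
Proof.
move=> s01; have /andP[s0 s1] := s01.
have r2 : 0 <= 1 - expR (- (r / 2)).
  by rewrite subr_ge0 -[leRHS]expR0 ler_expR oppr_le0 divr_ge0// ltW.
apply: le_trans (expected_loss_ge_surv r_gt0 sigma_gt0 GE B_bm X_start X_bs s01).
rewrite -mulrA ler_wpM2l//.
have sn0 : s != 0 by rewrite gt_eqF.
have D14 : 0 < 14 * D by rewrite mulr_gt0.
set k := (14 * D) `^ (1 / 3); have k0 : 0 < k by exact: powR_gt0.
have k3 : k ^+ 3 = 14 * D.
  rewrite /k -powR_mulrn ?powR_ge0// -powRrM (_ : 1 / 3 * 3%:R = 1 :> R); last by field.
  by rewrite powRr1// ltW.
(* For this K the error term D / K^3 is half of the lower bound s^(1/2) / 7. *)
pose K := k * s `^ (- (1 / 6)).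
have K0 : 0 < K by rewrite mulr_gt0// powR_gt0.
have K3 : D / K ^+ 3 = Num.sqrt s / 14.
  rewrite /K exprMn k3 -(powR_mulrn 3 (powR_ge0 _ _)) -powRrM.
  rewrite (_ : - (1 / 6) * 3%:R = - (2^-1) :> R); last by field.
  rewrite powRN powR12_sqrt ?(ltW s0)//.
  by field; rewrite !gt_eqF ?sqrtr_gt0.
have := surv0_le_surv mu sigma_gt0 B_bm s0 (unit_steps_le s01) K0.
rewrite K3 => /(le_trans (surv0_ge B_bm s01)) H.
have {}H : Num.sqrt s / 14 <= K * survival P B s (mu * s / sigma) (unit_steps s) by lra.
rewrite -(ler_pM2l K0); apply: le_trans H.
have -> : s `^ (2 / 3) = Num.sqrt s * s `^ (1 / 6).
  by rewrite -powR12_sqrt ?(ltW s0)// -powRD ?sn0 ?implybT//; congr (s `^ _); by field.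
rewrite /K powRN le_eqVlt; apply/orP; left; apply/eqP.
by field; rewrite !gt_eqF ?powR_gt0.
Qed.

Lemma expectation_discountB s t : 0 < s -> 0 < t ->
  expectation P (fun w => discount r (grid_hitting_time X G t w)
                      - discount r (grid_hitting_time X G s w)) =
  (L s - L t)%:E.
Proof.
move=> s0 t0; rewrite unlock EFinB !expected_lossE// -integralB_EFin//; last 2 first.
- exact: integrable_discount_loss.
- exact: integrable_discount_loss.
by apply: eq_integral => w _; rewrite -EFinB /discount_loss; congr (_%:E); ring.
Qed.

(** Started on the boundary, the process is found in G almost at once when it is
observed on a fine grid. *)
Lemma expected_loss_cvg0 : L t @[t --> 0^'+] --> 0.
Proof.
apply: (@squeeze_cvgr _ _ _ _ (cst 0) (fun t => (r + 1) * (2 + D) * t `^ (3 / 8))).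
- near=> t; rewrite expected_loss_ge0//= expected_loss_le_three_eighths//.
  by apply/andP; split; near: t; [exact: nbhs_right_gt|exact: nbhs_right_lt].
- exact: cvg_cst.
- rewrite -[X in _ --> X](mulr0 ((r + 1) * (2 + D))).
  by apply: cvgMr; apply: powR_cvg0; lra.
Unshelve. all: by end_near. Qed.

Lemma rho_expected_loss s : 0 < s ->
  lim ((fun t : R =>
          expectation P
            (fun w => discount r (grid_hitting_time X G t w)
                      - discount r (grid_hitting_time X G s w)))
       @ 0^'+) = (L s)%:E.
Proof.
move=> s0; apply/cvg_lim => //.
have : (L s - L t)%:E @[t --> 0^'+] --> (L s)%:E.
  apply: cvg_EFin; first exact: nearW.
  rewrite -[X in _ --> X]subr0; apply: cvgB; [exact: cvg_cst|exact: expected_loss_cvg0].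
apply: cvg_trans; apply: near_eq_cvg; near=> t.
by rewrite expectation_discountB.
Unshelve. all: by end_near. Qed.

End rates.

Theorem corollary3p1 (R : realType) (d : measure_display)
    (T : measurableType d) (P : R -> probability T R)
    (X B : R -> {mfun T >-> R}) (r sigma gamma mu : R) (G : set R)
    (r_gt0 : 0 < r) (sigma_gt0 : 0 < sigma)
    (GE : G = `]-oo, gamma]%classic \/ G = `]-oo, gamma[%classic)
    (muE : mu = r - sigma ^+ 2 / 2)
    (B_bm : forall x : R, brownian_motion (P x) B)
    (X_start : forall x : R, {ae P x, forall w, X 0 w = x})
    (X_bs : forall x : R, {ae P x, forall w, forall t : R, 0 <= t ->
      X t w = X 0 w + sigma * B t w + mu * t}) :
  (0 <= mu ->
    exists c0 C0 : R, [/\ 0 < c0, 0 < C0 &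
      \forall s \near 0^'+,
        ((c0 * s `^ (1 / 2))%:E <= rho P X r G s gamma)%E /\
        (rho P X r G s gamma <= (C0 * s `^ (1 / (2 * Num.sqrt 2)))%:E)%E]) /\
  (mu <= 0 -> mu ^+ 2 / (2 * sigma ^+ 2) < r ->
    exists c1 C1 : R, [/\ 0 < c1, 0 < C1 &
      \forall s \near 0^'+,
        ((c1 * s `^ (1 / Num.sqrt 2))%:E <= rho P X r G s gamma)%E /\
        (rho P X r G s gamma <= (C1 * s `^ (1 / 2))%:E)%E]).
Proof.
have rhoE (s : R) : 0 < s -> rho P X r G s gamma = (expected_loss X G r s (P gamma))%:E.
  move=> s0; exact: (rho_expected_loss r_gt0 sigma_gt0 GE (B_bm gamma)
    (X_start gamma) (X_bs gamma) s0).
have r2 : 0 < 1 - expR (- (r / 2)).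
  by rewrite subr_gt0 -[ltRHS]expR0 ltr_expR oppr_lt0 divr_gt0.
have D0 := girsanov_bound_gt0 sigma mu.
(* The exponents 3/8 and 2/3 suffice by these two bounds on sqrt 2. *)
have sqrt2 : 4 / 3 <= Num.sqrt (2 : R) <= 3 / 2.
  by apply/andP; split; rewrite -(ler_pXn2r (ltn0Sn 1)) ?nnegrE ?sqrtr_ge0//
    sqr_sqrtr//; lra.
have /andP[sqrt2_ge sqrt2_le] := sqrt2.
have sqrt2_gt0 : 0 < Num.sqrt (2 : R) by lra.
split=> [mu0|mu0 _].
  exists ((1 - expR (- (r / 2))) / 7), ((r + 1) * (2 + girsanov_bound sigma mu)).
  split; first by rewrite divr_gt0.
    by rewrite mulr_gt0 ?addr_gt0.
  near=> s.
  have s01 : 0 < s < 1.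
    by apply/andP; split; near: s; [exact: nbhs_right_gt|exact: nbhs_right_lt].
  have /andP[s0 s1] := s01.
  rewrite rhoE// !lee_fin; split.
    exact: (expected_loss_ge_sqrt r_gt0 sigma_gt0 GE (B_bm gamma)
      (X_start gamma) (X_bs gamma)).
  apply: le_trans (expected_loss_le_three_eighths r_gt0 sigma_gt0 GE (B_bm gamma)
    (X_start gamma) (X_bs gamma) s01) _.
  rewrite ler_pM2l ?mulr_gt0 ?addr_gt0//.
  apply: ger_powR; first by rewrite s0 ltW.
  by rewrite ler_pdivrMr ?mulr_gt0//; lra.
exists ((1 - expR (- (r / 2))) /
  (14 * (14 * girsanov_bound sigma mu) `^ (1 / 3))), (2 * (r + 1)).
split; first by rewrite divr_gt0// mulr_gt0// powR_gt0// mulr_gt0.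
  by rewrite mulr_gt0 ?addr_gt0.
near=> s.
have s01 : 0 < s < 1.
  by apply/andP; split; near: s; [exact: nbhs_right_gt|exact: nbhs_right_lt].
have /andP[s0 s1] := s01.
rewrite rhoE// !lee_fin; split; last first.
  exact: (expected_loss_le_sqrt r_gt0 sigma_gt0 GE (B_bm gamma)
    (X_start gamma) (X_bs gamma)).
apply: le_trans (expected_loss_ge_two_thirds r_gt0 sigma_gt0 GE (B_bm gamma)
  (X_start gamma) (X_bs gamma) s01).
rewrite ler_pM2l; last by rewrite divr_gt0// mulr_gt0// powR_gt0// mulr_gt0.
apply: ger_powR; first by rewrite s0 ltW.
by rewrite ler_pdivlMr//; lra.
Unshelve. all: by end_near. Qed.
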